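(* Let $\mathcal{M}$ be the family of isometry classes of extended metric spaces, let $\sim$ be the equivalence relation on $\mathcal{M}$ and $\rho$ the pseudometric on $\mathcal{M}$ defined in the context, let $\rho$ also denote the induced metric on $\mathcal{M}/\!\sim$, and let $(\mathcal{H},d_{\mathrm{GH}})$ be the Gromov-Hausdorff space. Then the following hold. (1) $(\mathcal{M}/\!\sim,\rho)$ is a compact metric space. (2) The natural projection $\mathcal{H}\ni X\mapsto [X]\in\mathcal{M}/\!\sim$ is a $3$-Lipschitz topological embedding map (with respect to $d_{\mathrm{GH}}$ and $\rho$). (3) The projection in (2) has dense image in $(\mathcal{M}/\!\sim,\rho)$. (4) For any $\rho$-convergent sequence of extended metric spaces, any ultralimit of it is equivalent (in the sense of $\sim$) to the $\rho$-limit.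
   Context: An extended metric space is a nonempty space with a metric taking values in $[0,+\infty]$. For extended metric spaces $X,Y$, write $X\precsim Y$ if for any finite sequence $x_1,\dots,x_N\in X$ there exist $y_{i,k}\in Y$ ($i=1,\dots,N$, $k=1,2,\dots$) with $d_X(x_i,x_j)\le\liminf_{k\to\infty}d_Y(y_{i,k},y_{j,k})$ for all $i,j$. Write $X\sim Y$ ($X$ is equivalent to $Y$) if $X\precsim Y$ and $Y\precsim X$; $\precsim$ is a preorder and $\sim$ an equivalence relation. $\mathcal{H}$ is the set of isometry classes of (nonempty) compact metric spaces with the Gromov-Hausdorff metric $d_{\mathrm{GH}}$. For integers $N\ge1$ and reals $D\ge0$, $\mathcal{H}(N,D)\subset\mathcal{H}$ is the set of isometry classes of metric spaces with at most $N$ points and diameter $\le D$. For an extended metric space $X$, $\mathcal{P}_X:=\{Y\in\mathcal{H}\mid Y\precsim X\}$. Define $$\rho_N(X,Y):=d_{\mathrm H}(\mathcal{P}_X\cap\mathcal{H}(N,N),\mathcal{P}_Y\cap\mathcal{H}(N,N)),\qquad \rho(X,Y):=\sum_{N=1}^\infty2^{-N}\rho_N(X,Y),$$ where $d_{\mathrm H}$ is the Hausdorff distance with respect to $d_{\mathrm{GH}}$. One has $\rho(X,Y)=0$ iff $X\sim Y$, so $\rho$ induces a metric on $\mathcal{M}/\!\sim$. Set-theoretic convention: a pyramid is a subset $\mathcal{P}\subset\mathcal{H}$ such that (i) $X\precsim Y\in\mathcal{P}$ implies $X\in\mathcal{P}$; (ii) for any $\varepsilon>0$ and $X,Y\in\mathcal{P}$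 there are $X',Y',Z\in\mathcal{P}$ with $d_{\mathrm{GH}}(X,X')\le\varepsilon$, $d_{\mathrm{GH}}(Y,Y')\le\varepsilon$ and $X',Y'\precsim Z$; (iii) $\mathcal{P}$ is nonempty and closed in $\mathcal{H}$. Since $\mathcal{M}$ is not a set, $\mathcal{M}/\!\sim$ is understood as the set of pyramids, via the bijection $[X]\mapsto\mathcal{P}_X$. Ultralimit: for a non-principal ultrafilter $\omega$ on the positive integers and extended metric spaces $X_n$, the ultralimit is the quotient of $\prod_nX_n$ by the relation of zero distance for $d_\omega((x_n),(y_n)):=\omega\text{-}\lim d_{X_n}(x_n,y_n)\in[0,+\infty]$, with the induced extended metric. *)

(* Defs.v *)
From HB Require Import structures.
From mathcomp Require Import all_boot all_order all_algebra.
From mathcomp Require Import all_classical all_reals all_analysis.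
Import numFieldNormedType.Exports.

Set Implicit Arguments.
Unset Strict Implicit.
Unset Printing Implicit Defensive.

Import Order.TTheory GRing.Theory Num.Theory.

Local Open Scope classical_set_scope.
Local Open Scope ring_scope.
Local Open Scope ereal_scope.
Local Open Scope quotient_scope.
Local Open Scope card_scope.

Definition is_metric (R : realType) (T : Type) (d : T -> T -> \bar R) : Prop :=
  [/\ forall x y, 0 <= d x y < +oo,
      forall x y, d x y = 0 <-> x = y,
      forall x y, d x y = d y x
    & forall x y z, d x z <= d x y + d y z].

(* [dtop d] is T with the topology of a distance function d: U is open iff
   every point of U is the centre of a d-ball of positive radius lying in U.
   These sets form a topology for any d whatsoever, so d need not be known to
   be a metric. *)
Definition dopen (R : realType) (T : Type) (d : T -> T -> \bar R) : set_system T :=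
  [set U | forall x, U x ->
     exists2 e : R, (0 < e)%R & [set y | d x y < e%:E] `<=` U].

Definition dtop (R : realType) (T : Type) (d : T -> T -> \bar R) : Type := T.

Section dtop_instance.
Context (R : realType) (T : Type) (d : T -> T -> \bar R).

Lemma dopenT : dopen d setT.
Proof. by move=> x _; exists 1%R. Qed.

Lemma dopenI : setI_closed (dopen d).
Proof.
move=> A B oA oB x [/oA[e e0 eA] /oB[f f0 fB]].
exists (Num.min e f); first by rewrite lt_min e0.
move=> y /= dxy; split; [apply: eA|apply: fB]; apply: lt_le_trans dxy _;
  by rewrite lee_fin ge_min lexx ?orbT.
Qed.

Lemma dopen_bigU (I : Type) (f : I -> set T) :
  (forall i, dopen d (f i)) -> dopen d (\bigcup_i f i).
Proof.
move=> of_ x [i _ /of_[e e0 ef]]; exists e => // y /ef fy; by exists i.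
Qed.

HB.instance Definition _ := gen_eqMixin (dtop d).
HB.instance Definition _ := gen_choiceMixin (dtop d).
HB.instance Definition _ :=
  @isOpenTopological.Build (dtop d) (dopen d) dopenT dopenI dopen_bigU.

End dtop_instance.

Definition topological_embedding (S T : topologicalType) (f : S -> T) : Prop :=
  [/\ injective f, continuous f
    & forall U : set S, open U -> exists2 V : set T, open V & f @^-1` V = U].

(* In the intended use A and B are nonempty (the supremum over the empty set
   is -oo). *)
Definition hausdorff_dist (R : realType) (T : Type) (d : T -> T -> \bar R)
    (A B : set T) : \bar R :=
  maxe (ereal_sup [set ereal_inf [set d a b | b in B] | a in A])
       (ereal_sup [set ereal_inf [set d a b | a in A] | b in B]).

Record emetric (R : realType) := Emetric {
  em_car :> Type;
  edist : em_car -> em_car -> \bar R;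
  edist_ge0 : forall x y, 0 <= edist x y;
  edist_eq0 : forall x y, edist x y = 0 <-> x = y;
  edistC : forall x y, edist x y = edist y x;
  edist_triangle : forall x y z, edist x z <= edist x y + edist y z;
  em_nonempty : [set: em_car] !=set0 }.
Arguments edist {R e}.

HB.instance Definition _ (R : realType) := gen_eqMixin (emetric R).
HB.instance Definition _ (R : realType) := gen_choiceMixin (emetric R).

Definition prec (R : realType) (X Y : emetric R) : Prop :=
  forall (N : nat) (x : 'I_N -> X), exists y : 'I_N -> nat -> Y,
    forall i j, edist (x i) (x j) <= limn_einf (fun k => edist (y i k) (y j k)).

Definition equivalent (R : realType) (X Y : emetric R) : Prop :=
  prec X Y /\ prec Y X.

Section prec_preorder.
Context {R : realType}.
Implicit Types (X Y Z : emetric R) (u : (\bar R)^nat).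

Lemma prec_refl X : prec X X.
Proof.
move=> N x; exists (fun i _ => x i) => i j.
by rewrite (cvg_limn_einf_sup (cvg_cst _)).1.
Qed.

Lemma lt_limn_einf u (b : R) :
  b%:E < limn_einf u -> \forall k \near \oo, b%:E < u k.
Proof.
rewrite limn_einf_lim (cvg_lim _ (@cvg_einfs_sup _ u))//.
move=> /ereal_sup_gt[_ [n _ <-] bn].
exists n => // k /= nk; apply: lt_le_trans bn _.
by apply: ereal_inf_lbound; exists k.
Qed.

Lemma lt_ereal_dense (a c : \bar R) : a < c -> exists b : R, a < b%:E < c.
Proof.
case: a c => [a||] [c||]//.
- rewrite lte_fin => ac; exists ((a + c) / 2)%R.
  by rewrite !lte_fin midf_lt// midf_lt.
- by move=> _; exists (a + 1)%R; rewrite lte_fin ltrDl ltr01 ltry.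
- by move=> _; exists (c - 1)%R; rewrite ltNyr lte_fin ltrBlDr ltrDl ltr01.
- by move=> _; exists 0%R; rewrite ltNyr ltry.
Qed.

Lemma le_limn_einf u (a : \bar R) :
  (forall b : R, b%:E < a -> \forall k \near \oo, b%:E <= u k) ->
  a <= limn_einf u.
Proof.
move=> h; rewrite limn_einf_lim (cvg_lim _ (@cvg_einfs_sup _ u))//.
rewrite leNgt; apply/negP => /lt_ereal_dense[b /andP[]].
rewrite ltNge => /negP + /h[n _ nu]; apply.
apply: (@le_trans _ _ (einfs u n)).
  by apply: le_ereal_inf_tmp => _ [k nk <-]; exact: nu.
by apply: ereal_sup_ubound; exists n.
Qed.

Lemma prec_trans X Y Z : prec X Y -> prec Y Z -> prec X Z.
Proof.
move=> XY YZ N x; have [y xy] := XY N x.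
pose c k i j : R := if edist (y i k) (y j k) is r%:E then (r - k.+1%:R^-1)%R
  else k%:R.
have c_lt k i j : (c k i j)%:E < edist (y i k) (y j k).
  rewrite /c; have := edist_ge0 (y i k) (y j k).
  case: (edist (y i k) (y j k)) => [r||] //= _.
    by rewrite lte_fin ltrBlDr ltrDl invr_gt0.
  by rewrite ltry.
have /choice[z zc] k : exists z : 'I_N -> Z,
    forall i j, (c k i j)%:E < edist (z i) (z j).
  have [z yz] := YZ N (fun i => y i k).
  have [l zl] : exists l, forall p : 'I_N * 'I_N,
      (c k p.1 p.2)%:E < edist (z p.1 l) (z p.2 l).
    suff : \forall l \near \oo, forall p : 'I_N * 'I_N,
      (c k p.1 p.2)%:E < edist (z p.1 l) (z p.2 l) by move/filter_ex.
    apply: filter_forall => p; apply: lt_limn_einf.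
    exact: lt_le_trans (c_lt _ _ _) (yz _ _).
  by exists (fun i => z i l) => i j; exact: (zl (i, j)).
exists (fun i k => z k i) => i j; apply: le_limn_einf => b bx.
have [b' /andP[bb' b'x]] := lt_ereal_dense bx.
have b'y := lt_limn_einf (lt_le_trans b'x (xy i j)).
have e0 : (0 < b' - b)%R by rewrite subr_gt0 -lte_fin.
near=> k; apply: le_trans (ltW (zc k i j)).
have kb : (b <= k%:R)%R by near: k; exact: nbhs_infty_ger.
have ke : (k.+1%:R^-1 < b' - b)%R.
  by near: k; exact: (near_infty_natSinv_lt (PosNum e0)).
have : b'%:E < edist (y i k) (y j k) by near: k.
rewrite lee_fin /c; case: edist => [r||]//=.
by rewrite lte_fin => b'r; rewrite lerBrDl -lerBrDr ltW// (lt_le_trans ke)// lerB// ltW.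
Unshelve. all: by end_near. Qed.

Lemma equivalent_refl X : equivalent X X.
Proof. by split; exact: prec_refl. Qed.

Lemma equivalent_sym X Y : equivalent X Y -> equivalent Y X.
Proof. by case. Qed.

Lemma equivalent_trans X Y Z :
  equivalent X Y -> equivalent Y Z -> equivalent X Z.
Proof.
by move=> [XY YX] [YZ ZY]; split; [exact: prec_trans XY YZ|exact: prec_trans ZY YX].
Qed.

End prec_preorder.

Definition equivalentb (R : realType) : rel (emetric R) :=
  fun X Y => `[< equivalent X Y >].

Section Mquot.
Variable R : realType.

Lemma equivalentb_refl : reflexive (@equivalentb R).
Proof. by move=> X; apply/asboolP; exact: equivalent_refl. Qed.

Lemma equivalentb_sym : symmetric (@equivalentb R).
Proof.
by move=> X Y; apply/idP/idP => /asboolP h; apply/asboolP; exact: equivalent_sym.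
Qed.

Lemma equivalentb_trans : transitive (@equivalentb R).
Proof.
move=> Y X Z /asboolP XY /asboolP YZ; apply/asboolP.
exact: equivalent_trans XY YZ.
Qed.

Canonical equivalent_equiv :=
  EquivRel _ equivalentb_refl equivalentb_sym equivalentb_trans.

(* The quotient M/~. Isometric spaces are equivalent (isometric_prec), so there
   is no need to pass to isometry classes first. *)
Definition Mquot := {eq_quot equivalent_equiv}.

End Mquot.

Definition Mclass (R : realType) (X : emetric R) : Mquot R := \pi X.

Lemma Mclass_eq (R : realType) (X Y : emetric R) :
  Mclass X = Mclass Y <-> equivalent X Y.
Proof. by rewrite /Mclass; split => [/eqmodP/asboolP|h]//; apply/eqmodP/asboolP. Qed.

Lemma Mrepr (R : realType) (X : emetric R) : equivalent (repr (Mclass X)) X.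
Proof. by apply/Mclass_eq; rewrite /Mclass reprK. Qed.

(* Metric spaces are the extended metric spaces with finite distances. The
   library's [metricType] cannot serve here: its carriers range over the same
   universe as those of [eqType], so the type of all metricTypes has no eqType
   structure, whereas the carriers of an [emetric] are taken one level below. *)
Definition finite_dist (R : realType) (X : emetric R) : Prop :=
  forall x y : X, edist x y < +oo.

Record cmetric (R : realType) := Cmetric {
  cm_space :> emetric R;
  cm_finite : finite_dist cm_space;
  cm_compact : compact [set: dtop (@edist R cm_space)] }.

HB.instance Definition _ (R : realType) := gen_eqMixin (cmetric R).
HB.instance Definition _ (R : realType) := gen_choiceMixin (cmetric R).

Definition isometric_map (R : realType) (X Y : emetric R) (f : X -> Y) : Prop :=
  forall x y, edist (f x) (f y) = edist x y.

Definition isometric (R : realType) (X Y : emetric R) : Prop :=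
  exists2 f : X -> Y, isometric_map f & bijective f.

(* The Gromov-Hausdorff distance: Z ranges over metric spaces. *)
Definition GHdist (R : realType) (X Y : emetric R) : \bar R :=
  ereal_inf [set h | exists (Z : emetric R) (f : X -> Z) (g : Y -> Z),
    [/\ finite_dist Z, isometric_map f, isometric_map g
      & h = hausdorff_dist (@edist R Z) (range f) (range g)]].

Section GHquot.
Variable R : realType.

Definition isometricb : rel (cmetric R) := fun X Y => `[< isometric X Y >].

Lemma isometricb_refl : reflexive isometricb.
Proof. by move=> X; apply/asboolP; exists id => //; exists id. Qed.

Lemma isometric_sym (X Y : emetric R) : isometric X Y -> isometric Y X.
Proof.
move=> [f iso_f [g fK gK]]; exists g; last by exists f.
by move=> x y; rewrite -iso_f !gK.
Qed.

Lemma isometricb_sym : symmetric isometricb.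
Proof.
by move=> X Y; apply/idP/idP => /asboolP h; apply/asboolP; exact: isometric_sym.
Qed.

Lemma isometricb_trans : transitive isometricb.
Proof.
move=> Y X Z /asboolP[f iso_f bf] /asboolP[g iso_g bg]; apply/asboolP.
by exists (g \o f); [move=> x y /=; rewrite iso_g iso_f|exact: bij_comp].
Qed.

Canonical isometric_equiv :=
  EquivRel _ isometricb_refl isometricb_sym isometricb_trans.

(* The set of isometry classes of nonempty compact metric spaces. *)
Definition GH := {eq_quot isometric_equiv}.

End GHquot.

Definition GHclass (R : realType) (X : cmetric R) : GH R := \pi X.

Lemma GHclass_eq (R : realType) (X Y : cmetric R) :
  GHclass X = GHclass Y <-> isometric X Y.
Proof. by rewrite /GHclass; split => [/eqmodP/asboolP|h]//; apply/eqmodP/asboolP. Qed.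

Lemma GHrepr (R : realType) (X : cmetric R) : isometric (repr (GHclass X)) X.
Proof. by apply/GHclass_eq; rewrite /GHclass reprK. Qed.

(* A compact metric space in the isometry class x. *)
Definition GHspace (R : realType) (x : GH R) : cmetric R := repr x.

Definition dGH (R : realType) (x y : GH R) : \bar R :=
  GHdist (GHspace x) (GHspace y).

Lemma GHdist_isometric (R : realType) (X X' Y Y' : emetric R) :
  isometric X X' -> isometric Y Y' -> GHdist X Y = GHdist X' Y'.
Proof.
suff le A A' B B' : isometric A A' -> isometric B B' ->
    GHdist (R := R) A B <= GHdist A' B'.
  move=> XX' YY'; apply/eqP; rewrite eq_le !le//; exact: isometric_sym.
move=> [u iu [u' uK u'K]] [v iv [v' vK v'K]]; apply: ereal_inf_le_tmp.
move=> _ [Z [f [g [fZ iF ig ->]]]]; exists Z, (f \o u), (g \o v); split=> //.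
- by move=> x y /=; rewrite iF iu.
- by move=> x y /=; rewrite ig iv.
- congr hausdorff_dist; apply/seteqP; split=> _ [x _ <-] /=.
  + by exists (u' x) => //=; rewrite u'K.
  + by exists (u x).
  + by exists (v' x) => //=; rewrite v'K.
  + by exists (v x).
Qed.

Lemma dGH_class (R : realType) (X Y : cmetric R) :
  dGH (GHclass X) (GHclass Y) = GHdist X Y.
Proof. by apply: GHdist_isometric; exact: GHrepr. Qed.

Lemma isometric_prec (R : realType) (X Y : emetric R) :
  isometric X Y -> prec X Y.
Proof.
move=> [f iso_f _] N x; exists (fun i _ => f (x i)) => i j.
by rewrite (cvg_limn_einf_sup (cvg_cst _)).1 iso_f.
Qed.

Lemma GHspace_class (R : realType) (X : cmetric R) :
  equivalent (GHspace (GHclass X)) X.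
Proof.
have h := GHrepr X; split; first exact: isometric_prec.
exact/isometric_prec/isometric_sym.
Qed.

(* H(N, D) *)
Definition GHbounded (R : realType) (N : nat) (D : R) : set (GH R) :=
  [set x | [set: GHspace x] #<= `I_N /\
           forall a b : GHspace x, edist a b <= D%:E].

(* P_X *)
Definition below (R : realType) (X : emetric R) : set (GH R) :=
  [set y | prec (GHspace y) X].

Definition rhoN (R : realType) (N : nat) (X Y : emetric R) : \bar R :=
  hausdorff_dist (@dGH R) (below X `&` GHbounded N N%:R)
                          (below Y `&` GHbounded N N%:R).

Definition rho (R : realType) (X Y : emetric R) : \bar R :=
  \sum_(1 <= N <oo) ((2 ^- N)%:E * rhoN N X Y).

Definition Mrho (R : realType) (x y : Mquot R) : \bar R := rho (repr x) (repr y).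

Lemma below_equivalent (R : realType) (X Y : emetric R) :
  equivalent X Y -> below X = below Y.
Proof.
by move=> [XY YX]; apply/seteqP; split => z /= /prec_trans; apply.
Qed.

Lemma Mrho_class (R : realType) (X Y : emetric R) :
  Mrho (Mclass X) (Mclass Y) = rho X Y.
Proof.
rewrite /Mrho /rho; apply: eq_eseriesr => N _; rewrite /rhoN.
by rewrite (below_equivalent (Mrepr X)) (below_equivalent (Mrepr Y)).
Qed.

Definition is_pyramid (R : realType) (P : set (GH R)) : Prop :=
  [/\ forall x y, prec (GHspace x) (GHspace y) -> P y -> P x,
      forall (e : R) x y, (0 < e)%R -> P x -> P y ->
        exists x' y' z, [/\ P x', P y' & P z] /\
          [/\ dGH x x' <= e%:E, dGH y y' <= e%:E,
              prec (GHspace x') (GHspace z) & prec (GHspace y') (GHspace z)],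
      P !=set0
    & closed (P : set (dtop (@dGH R)))].

Definition Mpyramid (R : realType) (x : Mquot R) : set (GH R) := below (repr x).

Lemma Mpyramid_class (R : realType) (X : emetric R) : Mpyramid (Mclass X) = below X.
Proof. exact: below_equivalent (Mrepr X). Qed.

Definition GHproj (R : realType) (x : GH R) : Mquot R := Mclass (GHspace x).

Definition nonprincipal (T : Type) (F : set_system T) : Prop :=
  forall x, ~ F [set x].

Lemma ultra_cvg_ereal (R : realType) (I : Type) (w : set_system I)
    (Uw : UltraFilter w) (u : I -> \bar R) : cvg (u @ w).
Proof.
pose c n := contract (u n).
have /segment_compact[a [a1]] : (c @ w) `[(-1)%R, 1%R]%classic.
  apply: (@filterE _ w) => n; rewrite /= in_itv /=.
  by have := contract_le1 (u n); rewrite ler_norml.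
rewrite /= in_itv /= -ler_norml in a1 => ca.
apply/cvg_ex; exists (expand a); apply/cvg_ballP => e e0.
have [//|nA] := in_ultra_setVsetC [set n | ball (expand a) e (u n)] Uw.
have /ca/(_ (nbhsx_ballx a e e0))[r []//] : (c @ w) (~` ball a e).
apply: (@filterS _ w _ _ _ _ nA) => n /=.
by rewrite /ball /= /ereal_ball expandK.
Qed.

(* The extended metric space obtained from an extended pseudometric d on T by
   identifying points at distance zero. The quotient is made of the equivalence
   classes themselves, which, unlike [{eq_quot _}], stay in the universe of T. *)
Section zero_quotient.
Context {R : realType} (T : Type) (d : T -> T -> \bar R).
Context (d_ge0 : forall x y, 0 <= d x y) (dxx : forall x, d x x = 0)
  (dC : forall x y, d x y = d y x)
  (d_triangle : forall x y z, d x z <= d x y + d y z)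
  (T_nonempty : [set: T] !=set0).

Definition zquot : Type := {C : T -> Prop | exists x, C = (fun y => d x y = 0)}.

Definition zpi (x : T) : zquot := exist _ _ (ex_intro _ x erefl).

Definition zrepr (p : zquot) : T := sval (cid (svalP p)).

Definition zdist (p q : zquot) : \bar R := d (zrepr p) (zrepr q).

Lemma zquot_inj (p q : zquot) : sval p = sval q -> p = q.
Proof.
by case: p q => [C hC] [D hD] /= CD; subst D; congr exist; exact: Prop_irrelevance.
Qed.

Lemma zreprK p : zpi (zrepr p) = p.
Proof. by apply: zquot_inj; rewrite /zrepr; case: cid. Qed.

Lemma d0_trans x y z : d x y = 0 -> d y z = 0 -> d x z = 0.
Proof.
move=> xy yz; apply/eqP; rewrite eq_le d_ge0 andbT.
by rewrite (le_trans (d_triangle x y z))// xy yz adde0.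
Qed.

Lemma zpi_eq x y : zpi x = zpi y <-> d x y = 0.
Proof.
split=> [[/(congr1 (fun C => C y))]|xy]; first by rewrite dxx => ->.
apply: zquot_inj; apply/funext => z; apply/propext; split; apply: d0_trans => //.
by rewrite dC.
Qed.

Lemma zdist_pi x y : zdist (zpi x) (zpi y) = d x y.
Proof.
have h z : d (zrepr (zpi z)) z = 0 by apply/zpi_eq; rewrite zreprK.
apply/eqP; rewrite eq_le /zdist; apply/andP; split.
- apply: le_trans (d_triangle _ x _) _; rewrite h add0e.
  by apply: le_trans (d_triangle _ y _) _; rewrite (dC y) h adde0.
- apply: le_trans (d_triangle _ (zrepr (zpi x)) _) _; rewrite dC h add0e.
  by apply: le_trans (d_triangle _ (zrepr (zpi y)) _) _; rewrite h adde0.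
Qed.

Lemma zdist_ge0 p q : 0 <= zdist p q.
Proof. exact: d_ge0. Qed.

Lemma zdist_eq0 p q : zdist p q = 0 <-> p = q.
Proof.
split=> [pq|->]; last exact: dxx.
by rewrite -(zreprK p) -(zreprK q); apply/zpi_eq.
Qed.

Lemma zdistC p q : zdist p q = zdist q p.
Proof. exact: dC. Qed.

Lemma zdist_triangle p q r : zdist p r <= zdist p q + zdist q r.
Proof. exact: d_triangle. Qed.

Lemma zquot_nonempty : [set: zquot] !=set0.
Proof. by case: T_nonempty => x _; exists (zpi x). Qed.

Definition zero_quotient : emetric R :=
  @Emetric R zquot zdist zdist_ge0 zdist_eq0 zdistC zdist_triangle zquot_nonempty.

End zero_quotient.

(* Sequences are indexed by nat instead of the positive integers. *)
Section ultralimit.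
Context {R : realType} (w : set_system nat) (Uw : UltraFilter w)
        (X : nat -> emetric R).

Definition udist (x y : forall n, X n) : \bar R :=
  lim ((fun n => edist (x n) (y n)) @ w).

Lemma udist_ge0 x y : 0 <= udist x y.
Proof.
apply: (cvge_ge _ (@ultra_cvg_ereal _ _ _ Uw _)).
by apply: nearW => n; exact: edist_ge0.
Qed.

Lemma udistxx x : udist x x = 0.
Proof.
rewrite /udist (_ : (fun _ => _) = cst 0) ?lim_cst//.
by apply/funext => n; apply/edist_eq0.
Qed.

Lemma udistC x y : udist x y = udist y x.
Proof.
by rewrite /udist; congr (lim (_ @ w)); apply/funext => n; rewrite edistC.
Qed.

Lemma udist_triangle x y z : udist x z <= udist x y + udist y z.
Proof.
have cv a b : (fun n => edist (a n) (b n)) @ w --> udist a b.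
  exact: ultra_cvg_ereal.
apply: (lee_cvg_to (cv x z) (cvgeD _ (cv x y) (cv y z))).
  by apply: ge0_adde_def; rewrite inE udist_ge0.
by apply: nearW => n; exact: edist_triangle.
Qed.

Lemma uprod_nonempty : [set: forall n, X n] !=set0.
Proof. by exists (fun n => sval (cid (em_nonempty (X n)))). Qed.

Definition ultralimit : emetric R :=
  zero_quotient udist_ge0 udistxx udistC udist_triangle uprod_nonempty.

End ultralimit.

(* Main.v *)
From Pilot Require Import Defs.
From HB Require Import structures.
From mathcomp Require Import all_boot all_order all_algebra.
From mathcomp Require Import all_classical all_reals all_analysis.
From mathcomp Require Import lra ring zify.
Import numFieldNormedType.Exports.
(* edist denotes the distance of an extended metric space from here on *)
Import Pilot.Defs.

(** Everything is reduced to finite matrices. A space X strictly dominates a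
    matrix b when it has points u_i with b_ij < d(u_i, u_j) for all i, j, and
    X precedes Y exactly when Y dominates every matrix that X dominates
    ([precP]). Domination is an open condition on b, and two matrices are both
    dominated by X if and only if a suitable block matrix is.

    The quantitative tool is the shrinking of a finite metric d by a constant
    c: the largest pseudometric below max(0, d - c) is still at least d - N c,
    where N is the number of points ([shrink_ge]). Hence a finite space F on N
    points whose matrix d - c is dominated by Y is within N c / 2 of a finite
    space that precedes Y ([shrunk_net]). Conversely, if rho_M(X, Y) is small,
    then the matrices dominated by X, truncated at M, are dominated by Y up to
    a small loss ([rhoN_lt_transfer]). So rho compares, on finitely many
    entries and up to a small error, the sets of dominated matrices.

    Compactness and ultralimits. The ultraproduct U of a family dominates, up
    to an arbitrarily small loss, precisely the matrices that almost all
    factors dominate. Since a finite grid of matrices controls rho_N, almost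
    all factors are rho_N-close to U ([ultraproduct_rhoN]). This gives a limit
    for every ultrafilter of classes, which is compactness, and it identifies
    the ultralimit of a convergent sequence with its limit.

    The projection of the Gromov-Hausdorff space. If d_GH(X, Y) < e, matching
    points changes distances by less than 2 e, so rho_N(X, Y) <= N e by
    shrinking, and the series of N / 2 ^ N has sum 2. For the topological
    embedding, choose in a compact space X an e-separated set of maximal
    cardinality, whose sum of distances is almost maximal among such sets. Its
    copy in a rho-close Y has distances almost as large; they cannot be much
    larger, and the copy must be a net of Y, since otherwise carrying it back
    to X would contradict one of the two maximalities
    ([compact_rhoN_GHdist]).

    Pyramids. In a pyramid P the matrices dominated by members of P are
    directed, so there is an ultrafilter on P along which each of them is
    eventually dominated. Its limit m in the compact space of classes has P as
    set of predecessors ([pyramid_realized]), and it is a limit of compact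
    spaces. As m is determined by P, both the bijection with the set of
    pyramids and the density of the compact spaces follow. *)

Set Implicit Arguments.
Unset Strict Implicit.
Unset Printing Implicit Defensive.

Import Order.TTheory GRing.Theory Num.Theory.

Local Open Scope classical_set_scope.
Local Open Scope ring_scope.
Local Open Scope ereal_scope.

(** * Extended reals and Hausdorff distances *)
Section Ereal.
Context {R : realType}.
Implicit Types (a b c : \bar R).

Lemma le_of_lt_fin a b : (forall r : R, b < r%:E -> a <= r%:E) -> a <= b.
Proof.
move=> h; rewrite leNgt; apply/negP => /lt_ereal_dense[r /andP[br ra]].
by have := h _ br; rewrite leNgt ra.
Qed.

Lemma le_add_of_lt_fin a b c : 0 <= b -> 0 <= c ->
  (forall r s : R, b < r%:E -> c < s%:E -> a <= (r + s)%:E) -> a <= b + c.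
Proof.
case: b => [b||]// b0; case: c => [c||]// c0 h; rewrite ?addey ?addye ?leey//.
apply/lee_addgt0Pr => e e0; have e20 : (0 < e / 2)%R by rewrite divr_gt0.
have -> : b%:E + c%:E + e%:E = (b + e / 2 + (c + e / 2))%:E.
  by rewrite -!EFinD; congr _%:E; lra.
by apply: h; rewrite lte_fin ltrDl.
Qed.

End Ereal.

Section Hausdorff.
Context {R : realType} (T : Type) (d : T -> T -> \bar R).
Implicit Types (A B C : set T).

Lemma hausdorff_distC : (forall x y, d x y = d y x) ->
  forall A B, hausdorff_dist d A B = hausdorff_dist d B A.
Proof.
move=> dC A B; rewrite /hausdorff_dist maxC; congr maxe; congr ereal_sup;
  apply/seteqP; split=> _ [x Ax <-]; exists x => //; congr ereal_inf;
  by apply/seteqP; split=> _ [y By <-]; exists y.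
Qed.

Lemma hausdorff_dist_le A B (r : R) :
  (forall a, A a -> exists2 b, B b & d a b <= r%:E) ->
  (forall b, B b -> exists2 a, A a & d a b <= r%:E) ->
  hausdorff_dist d A B <= r%:E.
Proof.
move=> AB BA; rewrite /hausdorff_dist ge_max; apply/andP; split;
  apply: ge_ereal_sup => _ [x + <-].
- move=> /AB[b Bb]; apply: le_trans; apply: ereal_inf_lbound; by exists b.
- move=> /BA[a Aa]; apply: le_trans; apply: ereal_inf_lbound; by exists a.
Qed.

Lemma hausdorff_dist_ltl A B c a :
  hausdorff_dist d A B < c -> A a -> exists2 b, B b & d a b < c.
Proof.
rewrite /hausdorff_dist gt_max => /andP[h _] Aa.
have /ereal_inf_lt[_ [b Bb <-] bc] : ereal_inf [set d a b | b in B] < c.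
  by apply: le_lt_trans h; apply: ereal_sup_ubound; exists a.
by exists b.
Qed.

Lemma hausdorff_dist_ltr A B c b :
  hausdorff_dist d A B < c -> B b -> exists2 a, A a & d a b < c.
Proof.
rewrite /hausdorff_dist gt_max => /andP[_ h] Bb.
have /ereal_inf_lt[_ [a Aa <-] ac] : ereal_inf [set d a b | a in A] < c.
  by apply: le_lt_trans h; apply: ereal_sup_ubound; exists b.
by exists a.
Qed.

Hypothesis d_ge0 : forall x y, 0 <= d x y.

Lemma hausdorff_dist_ge0 A B : A !=set0 -> 0 <= hausdorff_dist d A B.
Proof.
move=> [a Aa]; rewrite /hausdorff_dist le_max; apply/orP; left.
apply: (@le_trans _ _ (ereal_inf [set d a b | b in B])).
  by apply: le_ereal_inf_tmp => _ [b _ <-].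
by apply: ereal_sup_ubound; exists a.
Qed.

Lemma hausdorff_dist_triangle A B C : A !=set0 -> B !=set0 ->
  (forall x y z, d x z <= d x y + d y z) ->
  hausdorff_dist d A C <= hausdorff_dist d A B + hausdorff_dist d B C.
Proof.
move=> A0 B0 tri; apply: le_add_of_lt_fin => [||r s AB BC];
  rewrite ?hausdorff_dist_ge0//.
apply: hausdorff_dist_le => [a Aa|c Cc].
- have [b Bb ab] := hausdorff_dist_ltl AB Aa.
  have [c Cc bc] := hausdorff_dist_ltl BC Bb.
  by exists c => //; apply: le_trans (tri _ b _) _; rewrite EFinD leeD// ltW.
- have [b Bb bc] := hausdorff_dist_ltr BC Cc.
  have [a Aa ab] := hausdorff_dist_ltr AB Bb.
  by exists a => //; apply: le_trans (tri _ b _) _; rewrite EFinD leeD// ltW.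
Qed.

End Hausdorff.

(** * Real pseudometrics and their quotients *)
Section Pseudometric.
Context {R : realType}.

Record pmetric (T : Type) := Pmetric {
  pd :> T -> T -> R;
  pdxx : forall x, pd x x = 0%R;
  pdC : forall x y, pd x y = pd y x;
  pd_triangle : forall x y z, (pd x z <= pd x y + pd y z)%R }.

Lemma pd_ge0 T (p : pmetric T) x y : (0 <= p x y)%R.
Proof.
have := pd_triangle p x y x; rewrite pdxx (pdC _ y x); lra.
Qed.

Definition pmetric_comp (S T : Type) (f : S -> T) (p : pmetric T) : pmetric S :=
  @Pmetric S (fun x y => p (f x) (f y)) (fun x => pdxx p (f x))
    (fun x y => pdC p (f x) (f y))
    (fun x y z => pd_triangle p (f x) (f y) (f z)).

Context (T : Type) (p : pmetric T) (t : T).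

Let pE x y := (p x y)%:E.

Let pE_ge0 x y : 0 <= pE x y.
Proof. by rewrite lee_fin pd_ge0. Qed.

Let pExx x : pE x x = 0.
Proof. by rewrite /pE pdxx. Qed.

Let pEC x y : pE x y = pE y x.
Proof. by rewrite /pE pdC. Qed.

Let pE_triangle x y z : pE x z <= pE x y + pE y z.
Proof. by rewrite lee_fin pd_triangle. Qed.

Definition pspace : emetric R :=
  zero_quotient pE_ge0 pExx pEC pE_triangle (ex_intro _ t I).

Definition pproj (x : T) : pspace := zpi pE x.

Lemma pprojE x y : edist (pproj x) (pproj y) = (p x y)%:E.
Proof. exact: (zdist_pi pE_ge0 pExx pEC pE_triangle). Qed.

Lemma pproj_surj (q : pspace) : exists x, pproj x = q.
Proof. by exists (zrepr q); exact: zreprK. Qed.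

Lemma pspace_finite : finite_dist pspace.
Proof.
move=> q q'; have [[x <-] [y <-]] := (pproj_surj q, pproj_surj q').
by rewrite pprojE ltry.
Qed.

End Pseudometric.
Arguments pmetric : clear implicits.

Section Rdist.
Context {R : realType}.
Implicit Types (X Y : emetric R).

(** On spaces with finite distances, inequalities between distances are
    handled over R, where linear arithmetic applies. *)
Definition rdist X (x y : X) : R := fine (edist x y).

Lemma rdistE X : finite_dist X -> forall x y : X, edist x y = (rdist x y)%:E.
Proof.
by move=> fX x y; rewrite fineK// ge0_fin_numE ?edist_ge0//; exact: fX.
Qed.

Lemma edistxx X (x : X) : edist x x = 0.
Proof. exact/edist_eq0. Qed.

Lemma rdistxx X (x : X) : rdist x x = 0%R.
Proof. by rewrite /rdist edistxx. Qed.

Lemma rdistC X (x y : X) : rdist x y = rdist y x.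
Proof. by rewrite /rdist edistC. Qed.

Lemma rdist_ge0 X (x y : X) : (0 <= rdist x y)%R.
Proof. by rewrite fine_ge0// edist_ge0. Qed.

Lemma rdist_triangle X : finite_dist X ->
  forall x y z : X, (rdist x z <= rdist x y + rdist y z)%R.
Proof.
by move=> fX x y z; rewrite -lee_fin EFinD -!(rdistE fX) edist_triangle.
Qed.

Definition rdist_pmetric X (fX : finite_dist X) : pmetric R X :=
  Pmetric (@rdistxx X) (@rdistC X) (rdist_triangle fX).

Lemma isometric_map_rdist X Y (f : X -> Y) : isometric_map f ->
  forall x y, rdist (f x) (f y) = rdist x y.
Proof. by move=> fi x y; rewrite /rdist fi. Qed.

End Rdist.

(** * Gluing and the Gromov-Hausdorff distance *)

Section Glue.
Context {R : realType} (X Y : emetric R).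
Hypotheses (fX : finite_dist X) (fY : finite_dist Y).
Context (I : Type) (i0 : I) (a : I -> X) (b : I -> Y) (r : R).
Hypothesis ab : forall i j, (rdist (a i) (a j) <= rdist (b i) (b j) + 2 * r)%R.
Hypothesis ba : forall i j, (rdist (b i) (b j) <= rdist (a i) (a j) + 2 * r)%R.

Let cross_set x y := [set (rdist x (a i) + r + rdist (b i) y)%R | i in [set: I]].
(** The cost of the cheapest bridge a_i -- b_i of length r between x and y.
    Bridges of length r cannot create shortcuts since d(a_i, a_j) and
    d(b_i, b_j) differ by at most 2 r. *)
Let cross x y : R := inf (cross_set x y).

Let r_ge0 : (0 <= r)%R.
Proof. by have := ab i0 i0; rewrite !rdistxx; lra. Qed.

Let cross_le x y i : (cross x y <= rdist x (a i) + r + rdist (b i) y)%R.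
Proof.
apply: ge_inf; last by exists i.
by exists 0%R => _ [j _ <-]; rewrite !addr_ge0 ?rdist_ge0.
Qed.

Let le_cross x y (m : R) :
  (forall i, (m <= rdist x (a i) + r + rdist (b i) y)%R) -> (m <= cross x y)%R.
Proof.
move=> h; apply: lb_le_inf; first by exists (rdist x (a i0) + r + rdist (b i0) y)%R, i0.
by move=> _ [i _ <-].
Qed.

Let gd (p q : X + Y) : R :=
  match p, q with
  | inl x, inl x' => rdist x x'
  | inr y, inr y' => rdist y y'
  | inl x, inr y => cross x y
  | inr y, inl x => cross x y
  end.

Fact gdxx p : gd p p = 0%R.
Proof. by case: p => ? /=; rewrite rdistxx. Qed.

Fact gdC p q : gd p q = gd q p.
Proof. by case: p q => ? [] ? //=; rewrite rdistC. Qed.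

Fact cross_trl x x' y : (cross x y <= rdist x x' + cross x' y)%R.
Proof.
rewrite -lerBlDl; apply: le_cross => i; rewrite lerBlDl.
by apply: le_trans (cross_le _ _ i) _; have := rdist_triangle fX x x' (a i); lra.
Qed.

Fact cross_trr x y y' : (cross x y <= cross x y' + rdist y' y)%R.
Proof.
rewrite -lerBlDr; apply: le_cross => i; rewrite lerBlDr.
by apply: le_trans (cross_le _ _ i) _; have := rdist_triangle fY (b i) y' y; lra.
Qed.

Fact le_crossX x x' y : (rdist x x' <= cross x y + cross x' y)%R.
Proof.
rewrite -lerBlDr; apply: le_cross => i; rewrite lerBlDr -lerBlDl.
apply: le_cross => j; rewrite lerBlDl.
have := rdist_triangle fX x (a i) x'; have := rdist_triangle fX (a i) (a j) x'.
have := rdist_triangle fY (b i) y (b j); have := ab i j.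
rewrite (rdistC y) (rdistC (a j)); lra.
Qed.

Fact le_crossY x y y' : (rdist y y' <= cross x y + cross x y')%R.
Proof.
rewrite -lerBlDr; apply: le_cross => i; rewrite lerBlDr -lerBlDl.
apply: le_cross => j; rewrite lerBlDl.
have := rdist_triangle fY y (b i) y'; have := rdist_triangle fY (b i) (b j) y'.
have := rdist_triangle fX (a i) x (a j); have := ba i j.
rewrite (rdistC (a i) x) (rdistC y (b i)); lra.
Qed.

Fact gd_triangle p q s : (gd p s <= gd p q + gd q s)%R.
Proof.
case: p q s => [x|y] [x'|y'] [x''|y''] /=; rewrite ?rdist_triangle//.
- exact: cross_trl.
- exact: le_crossX.
- exact: cross_trr.
- by have := cross_trl x'' x' y; rewrite (rdistC x''); lra.
- exact: le_crossY.
- by have := cross_trr x'' y y'; rewrite (rdistC y'); lra.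
Qed.

(** This covers both the spaces realizing a small Gromov-Hausdorff distance
    (r > 0, almost isometric nets) and the amalgam of two spaces along a common
    subspace (r = 0), which the triangle inequality requires. *)
Lemma glue : exists (Z : emetric R) (f : X -> Z) (g : Y -> Z),
  [/\ finite_dist Z, isometric_map f, isometric_map g
    & forall i x y,
        edist (f x) (g y) <= (rdist x (a i) + r + rdist (b i) y)%:E].
Proof.
pose p := Pmetric gdxx gdC gd_triangle.
pose t : X + Y := inl (a i0).
exists (pspace p t), (fun x => pproj p t (inl x)), (fun y => pproj p t (inr y)).
split=> [|x x'|y y'|i x y]; rewrite ?pprojE ?rdistE//.
exact: pspace_finite.
by rewrite lee_fin; exact: cross_le.
Qed.

End Glue.

Section GromovHausdorff.
Context {R : realType}.
Implicit Types (X Y W : emetric R).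

Lemma GHdist_le X Y (I : Type) (i0 : I) (a : I -> X) (b : I -> Y) (r s : R) :
  finite_dist X -> finite_dist Y ->
  (forall i j, (rdist (a i) (a j) <= rdist (b i) (b j) + 2 * r)%R) ->
  (forall i j, (rdist (b i) (b j) <= rdist (a i) (a j) + 2 * r)%R) ->
  (forall x, exists i, (rdist x (a i) <= s)%R) ->
  (forall y, exists i, (rdist (b i) y <= s)%R) ->
  GHdist X Y <= (r + s)%:E.
Proof.
move=> fX fY ab ba sa sb.
have [Z [f [g [fZ fi gi fg]]]] := glue fX fY i0 ab ba.
apply: le_trans (_ : hausdorff_dist (@edist R Z) (range f) (range g) <= _).
  by apply: ereal_inf_lbound; exists Z, f, g.
apply: hausdorff_dist_le => _ [z _ <-].
- have [i iz] := sa z; exists (g (b i)); first by exists (b i).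
  by apply: le_trans (fg i _ _) _; rewrite lee_fin rdistxx; lra.
- have [i iz] := sb z; exists (f (a i)); first by exists (a i).
  by apply: le_trans (fg i _ _) _; rewrite lee_fin rdistxx; lra.
Qed.

Lemma GHdist_ge0 X Y : 0 <= GHdist X Y.
Proof.
apply: le_ereal_inf_tmp => _ [Z [f [g [_ _ _ ->]]]].
apply: hausdorff_dist_ge0; first exact: edist_ge0.
by have [x _] := em_nonempty X; exists (f x), x.
Qed.

Lemma GHdistC X Y : GHdist X Y = GHdist Y X.
Proof.
congr ereal_inf; apply/seteqP; split=> _ [Z [f [g [fZ fi gi ->]]]];
  exists Z, g, f; split=> //; apply: hausdorff_distC; exact: edistC.
Qed.

Lemma GHdist_lt X Y c : GHdist X Y < c ->
  exists (Z : emetric R) (f : X -> Z) (g : Y -> Z),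
    [/\ finite_dist Z, isometric_map f, isometric_map g,
        forall x, exists y, edist (f x) (g y) < c
      & forall y, exists x, edist (f x) (g y) < c].
Proof.
move=> /ereal_inf_lt[_ [Z [f [g [fZ fi gi ->]]]] h].
exists Z, f, g; split=> // [x|y].
- have [|_ [y _ <-] xy] := hausdorff_dist_ltl (a := f x) h; first by exists x.
  by exists y.
- have [|_ [x _ <-] xy] := hausdorff_dist_ltr (b := g y) h; first by exists y.
  by exists x.
Qed.

Lemma GHdist_triangle X Y W : GHdist X W <= GHdist X Y + GHdist Y W.
Proof.
apply: le_add_of_lt_fin; rewrite ?GHdist_ge0// => r s.
move=> /GHdist_lt[Z [f [g [fZ fi gi fg gf]]]].
move=> /GHdist_lt[Z' [f' [g' [fZ' fi' gi' fg' gf']]]].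
have gf0 i j : (rdist (g i) (g j) <= rdist (f' i) (f' j) + 2 * 0)%R.
  by rewrite !isometric_map_rdist// mulr0 addr0.
have fg0 i j : (rdist (f' i) (f' j) <= rdist (g i) (g j) + 2 * 0)%R.
  by rewrite !isometric_map_rdist// mulr0 addr0.
have [y0 _] := em_nonempty Y.
have [V [h [k [fV hi ki hk]]]] := glue fZ fZ' y0 gf0 fg0.
have le x y w : edist (f x) (g y) < r%:E -> edist (f' y) (g' w) < s%:E ->
    edist (h (f x)) (k (g' w)) <= (r + s)%:E.
  rewrite !rdistE// !lte_fin => xy yw; rewrite -(rdistE fV).
  by apply: le_trans (hk y _ _) _; rewrite lee_fin; lra.
apply: le_trans (_ : hausdorff_dist (@edist R V) (range (h \o f)) (range (k \o g'))
   <= _).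
  apply: ereal_inf_lbound; exists V, (h \o f), (k \o g').
  by split=> // x x' /=; rewrite ?hi ?ki.
apply: hausdorff_dist_le => _ [z _ <-].
- have [y yz] := fg z; have [w wy] := fg' y.
  by exists (k (g' w)); [exists w|exact: le yz wy].
- have [y yz] := gf' z; have [x xy] := gf y.
  by exists (h (f x)); [exists x|exact: le xy yz].
Qed.

(** Sending x to a point at distance less than e in a common space moves both
    endpoints of a segment by less than e, whence the constant 2 e. *)
Lemma GHdist_lt_approx X Y (e : R) : GHdist X Y < e%:E ->
  exists f : X -> Y,
    [/\ forall x x', (rdist x x' < rdist (f x) (f x') + 2 * e)%R,
        forall x x', (rdist (f x) (f x') < rdist x x' + 2 * e)%R
      & forall y, exists x, (rdist (f x) y < 2 * e)%R].
Proof.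
move=> /GHdist_lt[Z [f [g [fZ fi gi /choice[h fh] gf]]]]; exists h.
have fh' x : (rdist (f x) (g (h x)) < e)%R by rewrite -lte_fin -rdistE.
split=> [x x'|x x'|y].
- rewrite -(isometric_map_rdist fi) -(isometric_map_rdist gi).
  have := rdist_triangle fZ (f x) (g (h x)) (f x').
  have := rdist_triangle fZ (g (h x)) (g (h x')) (f x').
  by have := fh' x; have := fh' x'; rewrite (rdistC (f x')); lra.
- rewrite -(isometric_map_rdist fi) -(isometric_map_rdist gi).
  have := rdist_triangle fZ (g (h x)) (f x) (g (h x')).
  have := rdist_triangle fZ (f x) (f x') (g (h x')).
  by have := fh' x; have := fh' x'; rewrite (rdistC (f x)); lra.
- have [x] := gf y; rewrite (rdistE fZ) lte_fin => xy; exists x.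
  rewrite -(isometric_map_rdist gi).
  have := rdist_triangle fZ (g (h x)) (f x) (g y).
  by have := fh' x; rewrite (rdistC (f x)); lra.
Qed.

End GromovHausdorff.

(** * Finite distance matrices dominated by a space *)

Section Dominates.
Context {R : realType}.
Implicit Types (X Y : emetric R) (b : nat -> nat -> R).

(** Matrices are indexed by natural numbers rather than by ordinals, so that
    sets of matrices are small enough to index an ultraproduct ([profile]). *)
Definition dominates X (N : nat) b : Prop :=
  exists u : nat -> X,
    forall i j, (i < N)%N -> (j < N)%N -> (b i j)%:E < edist (u i) (u j).

(** Strict domination by a single tuple replaces the lower limits: a matrix
    strictly below the lower limits is eventually below the sequence, and
    conversely matrices increasing to the distances in X provide the sequence
    of tuples in Y. *)
Lemma precP X Y :
  prec X Y <-> forall N b, dominates X N b -> dominates Y N b.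
Proof.
split=> [XY N b [u bu]|h N x].
- have [y xy] := XY N (fun i => u i).
  have [y0 _] := em_nonempty Y.
  have : \forall k \near \oo, forall p : 'I_N * 'I_N,
      (b p.1 p.2)%:E < edist (y p.1 k) (y p.2 k).
    apply: filter_forall => -[i j] /=; apply: lt_limn_einf.
    exact: lt_le_trans (bu _ _ (ltn_ord i) (ltn_ord j)) (xy i j).
  move=> /filter_ex[k bk].
  exists (fun n => if insub n is Some i then y i k else y0) => i j iN jN.
  by rewrite !insubT; exact: (bk (Ordinal iN, Ordinal jN)).
- have [x0 _] := em_nonempty X.
  pose u n := if insub n is Some i then x i else x0.
  have uE (i : 'I_N) : u i = x i by rewrite /u valK.
  pose b k i j : R := if edist (u i) (u j) is r%:E then (r - k.+1%:R^-1)%R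
    else k%:R.
  have /choice[v bv] k : exists v : nat -> Y, forall i j, (i < N)%N ->
      (j < N)%N -> (b k i j)%:E < edist (v i) (v j).
    apply: h; exists u => i j _ _; rewrite /b; have := edist_ge0 (u i) (u j).
    case: edist => [r||]//= _; last by rewrite ltry.
    by rewrite lte_fin ltrBlDr ltrDl invr_gt0.
  exists (fun i k => v k i) => i j; apply: le_limn_einf => r rx.
  have bk k : b k i j = if edist (x i) (x j) is r%:E then (r - k.+1%:R^-1)%R
    else k%:R by rewrite /b !uE.
  have le k : (r <= b k i j)%R -> r%:E <= edist (v k i) (v k j).
    move=> rb; apply: le_trans (ltW (bv k i j (ltn_ord i) (ltn_ord j))).
    by rewrite lee_fin.
  case: (edist (x i) (x j)) rx bk => [s||]// rx bk; last first.
    by near=> k; apply: le; rewrite bk; near: k; exact: nbhs_infty_ger.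
  rewrite lte_fin -subr_gt0 in rx; near=> k; apply: le; rewrite bk.
  have ks : (k.+1%:R^-1 < s - r)%R.
    by near: k; exact: (near_infty_natSinv_lt (PosNum rx)).
  by rewrite lerBrDr -lerBrDl ltW.
Unshelve. all: by end_near. Qed.

Lemma prec_dominates X Y N b : prec X Y -> dominates X N b -> dominates Y N b.
Proof. by move/precP; apply. Qed.

Lemma expanding_prec X Y (f : X -> Y) :
  (forall x x', edist x x' <= edist (f x) (f x')) -> prec X Y.
Proof.
move=> h; apply/precP => N b [u bu]; exists (f \o u) => i j iN jN.
exact: lt_le_trans (bu _ _ iN jN) (h _ _).
Qed.

Lemma dominates_le X N b b' :
  (forall i j, (i < N)%N -> (j < N)%N -> (b' i j <= b i j)%R) ->
  dominates X N b -> dominates X N b'.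
Proof.
move=> bb' [u bu]; exists u => i j iN jN.
by apply: le_lt_trans (bu _ _ iN jN); rewrite lee_fin bb'.
Qed.

Lemma lt_edist_open X N b (u : nat -> X) :
  (forall i j, (i < N)%N -> (j < N)%N -> (b i j)%:E < edist (u i) (u j)) ->
  exists2 e : R, (0 < e)%R & forall i j, (i < N)%N -> (j < N)%N ->
    (b i j + e)%:E < edist (u i) (u j).
Proof.
move=> bu.
have : \forall e \near (0%R : R)^'+, forall p : 'I_N * 'I_N,
    (b p.1 p.2 + e)%:E < edist (u p.1) (u p.2).
  apply: filter_forall => -[i j] /=.
  have := bu _ _ (ltn_ord i) (ltn_ord j); case: edist => [r||]//=.
    rewrite lte_fin -subr_gt0 => br; near=> e.
    by rewrite lte_fin -ltrBrDl; near: e; exact: nbhs_right_lt.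
  by move=> _; apply: nearW => e; rewrite ltry.
move=> h; near (0%R : R)^'+ => e; exists e; first by near: e; exact: nbhs_right_gt.
have eh : forall p : 'I_N * 'I_N, (b p.1 p.2 + e)%:E < edist (u p.1) (u p.2).
  by near: e.
by move=> i j iN jN; exact: (eh (Ordinal iN, Ordinal jN)).
Unshelve. all: by end_near. Qed.

Lemma dominates_open X N b : dominates X N b ->
  exists2 e : R, (0 < e)%R & dominates X N (fun i j => b i j + e)%R.
Proof. by move=> [u /lt_edist_open[e e0 bu]]; exists e => //; exists u. Qed.

Lemma dominates_GHdist X Y N b (e : R) : finite_dist X -> finite_dist Y ->
  GHdist X Y < e%:E -> dominates X N (fun i j => b i j + 2 * e)%R ->
  dominates Y N b.
Proof.
move=> fX fY /GHdist_lt_approx[f [h _ _]] [u bu].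
exists (f \o u) => i j iN jN; have := bu i j iN jN; have := h (u i) (u j).
by rewrite (rdistE fX) (rdistE fY) !lte_fin /=; lra.
Qed.

(** The block matrix of b and b'; the negative entries outside the two blocks
    impose no condition. *)
Definition merge (N : nat) b b' (i j : nat) : R :=
  if (i < N)%N && (j < N)%N then b i j
  else if (N <= i)%N && (N <= j)%N then b' (i - N)%N (j - N)%N
  else (-1)%R.

Lemma dominates_merge X N N' b b' :
  dominates X (N + N') (merge N b b') <-> dominates X N b /\ dominates X N' b'.
Proof.
split=> [[u bu]|[[u bu] [u' bu']]].
- split.
  + exists u => i j iN jN.
    by have := bu i j; rewrite /merge iN jN; apply; exact: ltn_addr.
  + exists (fun i => u (N + i)%N) => i j iN jN.
    have := bu (N + i)%N (N + j)%N; rewrite /merge !ltn_add2l !addKn.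
    by rewrite !ltnNge !leq_addr /= -!ltnNge; apply.
- exists (fun i => if (i < N)%N then u i else u' (i - N)%N) => i j iN jN.
  have [ltiN|leiN] := ltnP i N; have [ltjN|lejN] := ltnP j N;
    rewrite /merge ?ltiN ?ltjN ?leiN ?lejN ?(ltnNge i) ?(ltnNge j)
      ?leiN ?lejN ?(leqNgt N) ?ltiN ?ltjN /=.
  + exact: bu.
  + by rewrite (lt_le_trans _ (edist_ge0 _ _))// lte_fin ltrN10.
  + by rewrite (lt_le_trans _ (edist_ge0 _ _))// lte_fin ltrN10.
  + by apply: bu'; lia.
Qed.

End Dominates.

(** * Shrinking a finite metric *)

Section Shrink.
Context {R : realType} (T : finType) (p : pmetric R T) (c : R).
Hypothesis c_ge0 : (0 <= c)%R.

Let step x y : R := Num.max 0%R (p x y - c)%R.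

Let step_ge0 x y : (0 <= step x y)%R.
Proof. by rewrite le_max lexx. Qed.

(** The length of the chain x :: s when each step is shortened by c. *)
Fixpoint chain_cost (x : T) (s : seq T) : R :=
  if s is y :: s' then (step x y + chain_cost y s')%R else 0%R.

Fact chain_cost_ge0 x s : (0 <= chain_cost x s)%R.
Proof. by elim: s x => //= y s IH x; rewrite addr_ge0. Qed.

Fact chain_cost_cat x s s' :
  chain_cost x (s ++ s') = (chain_cost x s + chain_cost (last x s) s')%R.
Proof. by elim: s x => [|y s IH] x /=; rewrite ?add0r// IH addrA. Qed.

Fact chain_cost_rev x s :
  exists2 s', last (last x s) s' = x & chain_cost (last x s) s' = chain_cost x s.
Proof.
elim: s x => [|y s IH] x /=; first by exists [::].
have [s' ls' cs'] := IH y; exists (s' ++ [:: x]); first by rewrite last_cat.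
by rewrite chain_cost_cat ls' cs' /= /step pdC addr0 addrC.
Qed.

(** A chain in A may be assumed to visit each point once, since deleting a loop
    only lowers its cost; it then has fewer than #|A| steps, and each of them
    loses at most c. *)
Fact le_chain_cost (A : {set T}) x s : x \in A -> {subset s <= A} ->
  (p x (last x s) - #|A|%:R * c <= chain_cost x s)%R.
Proof.
have [n] := ubnP (size s); elim: n => // n IH in A x s * => sn xA sA.
have [xs|xs] := boolP (x \in s).
  (* cutting a loop at x *)
  case/splitPr: xs sn sA => s1 s2; rewrite size_cat /= => sn sA.
  rewrite last_cat chain_cost_cat /=.
  apply: (@le_trans _ _ (chain_cost x s2)).
    apply: IH => //.
      by move: sn; rewrite addnS ltnS; exact: leq_ltn_trans (leq_addl _ _).
    by move=> z z2; apply: sA; rewrite mem_cat inE z2 !orbT.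
  by rewrite addrA lerDr addr_ge0 ?chain_cost_ge0.
case: s => [|y s] /= in sn sA xs *.
  by rewrite pdxx sub0r oppr_le0 mulr_ge0.
have yA : y \in A :\ x.
  by rewrite !inE sA ?mem_head// andbT; apply: contraNneq xs => ->; exact: mem_head.
have sAx : {subset s <= A :\ x}.
  move=> z zs; rewrite !inE sA ?inE ?zs ?orbT// andbT.
  by apply: contraNneq xs => <-; rewrite inE zs orbT.
have := IH (A :\ x) y s sn yA sAx; rewrite (cardsD1 x A) xA add1n -(addn1 #|_|).
rewrite natrD mulrDl mul1r.
have : (p x y - c <= step x y)%R by rewrite le_max lexx orbT.
by have := pd_triangle p x y (last y s); lra.
Qed.

Let chain_costs x y := [set chain_cost x s | s in [set s | last x s = y]].

(** The largest pseudometric below max(0, p - c). The function max(0, p - c)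
    itself violates the triangle inequality, and scaling p instead would not
    give an error that is linear in c. *)
Definition shrink (x y : T) : R := inf (chain_costs x y).

Fact shrink_le_cost x s : (shrink x (last x s) <= chain_cost x s)%R.
Proof.
by apply: ge_inf; [exists 0%R => _ [? _ <-]; exact: chain_cost_ge0|exists s].
Qed.

Fact le_shrink x y m : (forall s, last x s = y -> (m <= chain_cost x s)%R) ->
  (m <= shrink x y)%R.
Proof.
move=> h; apply: lb_le_inf; first by exists (chain_cost x [:: y]), [:: y].
by move=> _ [s /= sy <-]; exact: h.
Qed.

Fact shrinkxx x : shrink x x = 0%R.
Proof.
apply/eqP; rewrite eq_le (shrink_le_cost x [::]) /=.
by apply: le_shrink => s _; exact: chain_cost_ge0.
Qed.

Fact shrink_leC x y : (shrink x y <= shrink y x)%R.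
Proof.
apply: le_shrink => s <-; have [s' ls' <-] := chain_cost_rev y s.
by rewrite -{2}ls'; exact: shrink_le_cost.
Qed.

Fact shrinkC x y : shrink x y = shrink y x.
Proof. by apply/eqP; rewrite eq_le !shrink_leC. Qed.

Fact shrink_triangle x y z : (shrink x z <= shrink x y + shrink y z)%R.
Proof.
rewrite -lerBlDr; apply: le_shrink => s <-; rewrite lerBlDr -lerBlDl.
apply: le_shrink => s' <-; rewrite lerBlDl -chain_cost_cat -last_cat.
exact: shrink_le_cost.
Qed.

Definition shrink_pmetric : pmetric R T :=
  Pmetric shrinkxx shrinkC shrink_triangle.

Lemma shrink_le x y : (shrink x y <= Num.max 0 (p x y - c))%R.
Proof. by have := shrink_le_cost x [:: y]; rewrite /= addr0. Qed.

Lemma shrink_le_dist x y : (shrink x y <= p x y)%R.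
Proof.
apply: le_trans (shrink_le x y) _; by rewrite ge_max pd_ge0 lerBlDr lerDl.
Qed.

Lemma shrink_ge x y : (p x y - #|T|%:R * c <= shrink x y)%R.
Proof.
by apply: le_shrink => s <-; rewrite -cardsT; apply: le_chain_cost.
Qed.

End Shrink.

(** * Finite metric spaces as points of the Gromov-Hausdorff space *)

Section ClassTransfer.
Context {R : realType}.
Implicit Types (X : emetric R) (Y : cmetric R).

Lemma GHbounded_class Y N (D : R) : ([set: Y] #<= `I_N)%card ->
  (forall y y' : Y, edist y y' <= D%:E) -> GHbounded N D (GHclass Y).
Proof.
move=> YN YD; have [f fi [g fK gK]] := GHrepr Y; split.
  apply: card_le_trans YN.
  have -> : [set: GHspace (GHclass Y)] = g @` [set: Y].
    by apply/seteqP; split=> // x _; exists (f x).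
  exact: card_image_le.
by move=> x x'; rewrite -fi.
Qed.

End ClassTransfer.

(** The carrier is a quotient of nat, where indices above n all stand for the
    point inord 0, because the ordinals live in too large a universe. *)
Section FiniteSpace.
Context {R : realType} (n : nat) (p : pmetric R 'I_n.+1).

Definition fin_space : emetric R :=
  pspace (pmetric_comp (@inord n) p) 0%N.

Definition fin_point (i : 'I_n.+1) : fin_space := pproj _ 0%N (val i).

Lemma fin_pointE i j : edist (fin_point i) (fin_point j) = (p i j)%:E.
Proof. by rewrite pprojE /= !inord_val. Qed.

Lemma fin_point_surj (x : fin_space) : exists i, fin_point i = x.
Proof.
have [k <-] := pproj_surj x; exists (inord k); apply/edist_eq0.
by rewrite pprojE /= inord_val pdxx.
Qed.

Lemma fin_space_card : ([set: fin_space] #<= `I_n.+1)%card.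
Proof.
have -> : [set: fin_space] =
    pproj (pmetric_comp (@inord n) p) 0%N @` `I_n.+1.
  apply/seteqP; split=> // x _; have [i <-] := fin_point_surj x.
  by exists (val i) => /=.
exact: card_image_le.
Qed.

Lemma fin_space_finite : finite_dist fin_space.
Proof. exact: pspace_finite. Qed.

Lemma fin_space_compact : compact [set: dtop (@edist R fin_space)].
Proof.
by apply: finite_compact; apply/finite_set_leP; exists n.+1; exact: fin_space_card.
Qed.

Definition fin_class : GH R := GHclass (Cmetric fin_space_finite fin_space_compact).

Lemma fin_class_prec (Y : emetric R) (u : 'I_n.+1 -> Y) :
  (forall i j, (p i j)%:E <= edist (u i) (u j)) -> prec (GHspace fin_class) Y.
Proof.
move=> pu; apply: prec_trans (GHspace_class _).1 _.
have /choice[f fK] := fin_point_surj.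
apply: (@expanding_prec _ fin_space _ (u \o f)) => x x'.
by have := pu (f x) (f x'); rewrite -fin_pointE !fK.
Qed.

Lemma fin_class_points : exists v : 'I_n.+1 -> GHspace fin_class,
  (forall i j, edist (v i) (v j) = (p i j)%:E) /\ forall x, exists i, v i = x.
Proof.
have [f fi [g fK gK]] := GHrepr (Cmetric fin_space_finite fin_space_compact).
exists (g \o fin_point); split=> [i j|x] /=; first by rewrite -fi !gK fin_pointE.
by have [i ix] := fin_point_surj (f x); exists i; rewrite ix fK.
Qed.

Lemma fin_class_bounded N (D : R) : (n < N)%N -> (forall i j, (p i j <= D)%R) ->
  GHbounded N D fin_class.
Proof.
move=> nN pD; apply: GHbounded_class.
  by apply: card_le_trans fin_space_card _; rewrite card_le_II.
move=> x y; have [[i <-] [j <-]] := (fin_point_surj x, fin_point_surj y).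
by rewrite fin_pointE lee_fin.
Qed.

End FiniteSpace.

(** * The topology of a distance function *)

Section Dtop.
Context {R : realType} (T : Type) (d : T -> T -> \bar R).

Lemma dtop_nbhs_sub (x : dtop d) (A : set (dtop d)) : nbhs x A ->
  exists2 e : R, (0 < e)%R & [set y | d x y < e%:E] `<=` A.
Proof.
rewrite nbhsE => -[B [oB Bx] BA]; have [e e0 eB] := oB _ Bx.
by exists e => //; apply: subset_trans BA.
Qed.

Hypotheses (d_ge0 : forall x y, 0 <= d x y) (dxx : forall x, d x x = 0)
  (d_triangle : forall x y z, d x z <= d x y + d y z).

Lemma dtop_open_ball x (e : R) : open ([set y | d x y < e%:E] : set (dtop d)).
Proof.
move=> y /= xy; have := d_ge0 x y; move: xy.
case E: (d x y) => [r||]//; rewrite lte_fin => re _.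
exists (e - r)%R; first by rewrite subr_gt0.
move=> z /= yz; apply: le_lt_trans (d_triangle x y z) _.
have -> : e%:E = d x y + (e - r)%:E by rewrite E -EFinD addrC subrK.
by rewrite lteD2lE// E.
Qed.

Lemma dtop_nbhs_ball x (e : R) : (0 < e)%R ->
  nbhs (x : dtop d) [set y | d x y < e%:E].
Proof.
by move=> e0; apply: open_nbhs_nbhs; split; [exact: dtop_open_ball|rewrite /= dxx].
Qed.

End Dtop.

Section CompactNet.
Context {R : realType} (X : emetric R).
Hypothesis cX : compact [set: dtop (@edist R X)].

(** Near covering along the finite lists of points, ordered by inclusion: each
    point is near a member of every list that contains it. *)
Lemma compact_net (s : R) : (0 < s)%R ->
  exists n (u : 'I_n.+1 -> X), forall x, exists i, edist x (u i) < s%:E.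
Proof.
move=> s0; pose B (l : seq X) := [set l' | forall y, List.In y l -> List.In y l'].
have fB : Filter (filter_from [set: seq X] B).
  apply: filter_fromT_filter; first by exists [::].
  move=> l l'; exists (l ++ l') => t h; split=> y yl; apply: h;
    apply: List.in_or_app; by [left|right].
have pB : ProperFilter (filter_from [set: seq X] B).
  by apply: filter_from_proper => // l _; exists l.
have [x _] := em_nonempty X.
have := (compact_near_coveringP _).1 cX _ _
  (fun l x => exists2 y, List.In y l & edist x y < s%:E) fB.
case/(_ _)/filter_ex => [y _|l lX].
  exists ([set z : X | edist y z < s%:E], [set l | List.In y l]) => /=.
    split; first exact: dtop_nbhs_ball (@edist_ge0 _ _) (@edistxx _ _)
      (@edist_triangle _ _) _ _ s0.
    by exists [:: y] => // l h; apply: h; left.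
  by move=> [z l] /= [yz ly]; exists y => //; rewrite edistC.
case: l lX => [|y l] lX; first by have [y []] := lX x Logic.I.
exists (size l), (fun i => nth y (y :: l) i) => z.
have [t tl zt] := lX z Logic.I.
suff [i il it] : exists2 i, (i < size (y :: l))%N & nth y (y :: l) i = t.
  by exists (Ordinal il); rewrite /= it.
elim: (y :: l) tl => //= w l' IH [->|/IH[i il <-]]; first by exists 0%N.
by exists i.+1.
Qed.

End CompactNet.

Section TruncatedSubspace.
Context {R : realType} (X : emetric R).

Section Truncation.
Context (M : R) (M_ge0 : (0 <= M)%R).

(** Truncation makes infinite distances finite and bounds the diameter, so that
    a finite subset of an extended metric space yields a point of H(M, M). *)
Definition trunc_dist (x y : X) : R := fine (mine (edist x y) M%:E).

Fact trunc_distE x y : (trunc_dist x y)%:E = mine (edist x y) M%:E.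
Proof.
rewrite fineK// ge0_fin_numE ?le_min ?edist_ge0 ?lee_fin//.
by rewrite gt_min ltry orbT.
Qed.

Fact trunc_distxx x : trunc_dist x x = 0%R.
Proof. by rewrite /trunc_dist edistxx min_l. Qed.

Fact trunc_distC x y : trunc_dist x y = trunc_dist y x.
Proof. by rewrite /trunc_dist edistC. Qed.

Fact trunc_dist_triangle x y z :
  (trunc_dist x z <= trunc_dist x y + trunc_dist y z)%R.
Proof.
have M0 : 0 <= M%:E by rewrite lee_fin.
rewrite -lee_fin EFinD !trunc_distE.
have [xy|xy] := leP (edist x y) M%:E; last first.
  by rewrite ge_min leeDl ?orbT// le_min edist_ge0.
have [yz|yz] := leP (edist y z) M%:E; last first.
  by rewrite ge_min leeDr ?orbT// edist_ge0.
by rewrite ge_min edist_triangle.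
Qed.

Definition trunc_pmetric : pmetric R X :=
  Pmetric trunc_distxx trunc_distC trunc_dist_triangle.

End Truncation.

Lemma truncated_subspace m (u : nat -> X) :
  exists2 F : GH R, (below X `&` GHbounded m.+1 m.+1%:R) F &
    exists v : nat -> GHspace F, forall i j, (i <= m)%N -> (j <= m)%N ->
      edist (v i) (v j) = mine (edist (u i) (u j)) m.+1%:R%:E.
Proof.
pose p := pmetric_comp (fun i : 'I_m.+1 => u i) (trunc_pmetric (ler0n R m.+1)).
have pE i j : (p i j)%:E = mine (edist (u i) (u j)) m.+1%:R%:E.
  by rewrite trunc_distE.
exists (fin_class p).
  split; first by apply: (@fin_class_prec _ _ p _ (fun i => u i)) => i j;
    rewrite pE ge_min lexx.
  by apply: fin_class_bounded => // i j; rewrite -lee_fin pE ge_min lexx orbT.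
have [v [vE _]] := fin_class_points p.
exists (fun i => v (inord i)) => i j im jm.
by rewrite vE pE !inordK.
Qed.

End TruncatedSubspace.

Section GHclasses.
Context {R : realType}.
Implicit Types (X Y : emetric R) (F : GH R).

Lemma dGH_ge0 F F' : 0 <= dGH F F'.
Proof. exact: GHdist_ge0. Qed.

Lemma dGHC F F' : dGH F F' = dGH F' F.
Proof. exact: GHdistC. Qed.

Lemma dGH_triangle F F' F'' : dGH F F'' <= dGH F F' + dGH F' F''.
Proof. exact: GHdist_triangle. Qed.

Lemma dGHxx F : dGH F F = 0.
Proof.
have fF := @cm_finite _ (GHspace F); have [x0 _] := em_nonempty (GHspace F).
apply/eqP; rewrite eq_le dGH_ge0 andbT -[X in _ <= X%:E](addr0 (0 : R)%R).
apply: (@GHdist_le _ _ _ _ x0 id id) => // [x y|x y|x|x]; rewrite ?mulr0 ?addr0//.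
- by exists x; rewrite rdistxx.
- by exists x; rewrite rdistxx.
Qed.

(** A finite subspace of X, truncated above all entries of b. *)
Lemma dominates_witness X N (b : nat -> nat -> R) : dominates X N b ->
  exists2 F, below X F & dominates (GHspace F) N b.
Proof.
move=> [u bu].
have : \forall m \near \oo, forall p : 'I_N * 'I_N, (b p.1 p.2 < m%:R)%R.
  by apply: filter_forall => p; exact: nbhs_infty_gtr.
move=> h; near \oo => m.
have bm : forall p : 'I_N * 'I_N, (b p.1 p.2 < m%:R)%R by near: m.
have Nm : (N <= m)%N by near: m; exact: nbhs_infty_ge.
have [F [XF _] [v vE]] := truncated_subspace m u.
exists F => //; exists v => i j iN jN.
rewrite vE ?(leq_trans (ltnW iN))// ?(leq_trans (ltnW jN))// lt_min bu//=.
rewrite lte_fin (lt_le_trans (bm (Ordinal iN, Ordinal jN)))//.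
by rewrite ler_nat.
Unshelve. all: by end_near. Qed.

(** The space F is the net with its metric shrunk by c. A tuple v of Y that
    dominates d - c also satisfies d(v_i, v_j) >= max(0, d_ij - c), which is at
    least the shrunk distance; hence F precedes Y. *)
Lemma shrunk_net X n (u : 'I_n.+1 -> X) (s c : R) : finite_dist X -> (0 <= c)%R ->
  (forall x, exists i, edist x (u i) <= s%:E) ->
  exists F, [/\ GHdist X (GHspace F) <= (s + n.+1%:R * c / 2)%:E,
    forall D, (forall x y : X, edist x y <= D%:E) -> GHbounded n.+1 D F
    & forall Y, dominates Y n.+1
        (fun i j => rdist (u (inord i)) (u (inord j)) - c)%R -> below Y F].
Proof.
move=> fX c0 us.
pose p := pmetric_comp u (rdist_pmetric fX); pose q := shrink_pmetric p c.
have [v [vE vs]] := fin_class_points q.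
have vE' i j : rdist (v i) (v j) = q i j by rewrite /rdist vE.
have [x0 _] := em_nonempty X.
have s0 : (0 <= s)%R.
  by have [i] := us x0; rewrite -lee_fin; exact/le_trans/edist_ge0.
exists (fin_class q); split=> [|D XD|Y [w uw]].
- rewrite addrC; apply: (@GHdist_le _ _ _ _ (@ord0 n) u v) => //.
  + exact: cm_finite.
  + move=> i j; have := shrink_ge p c0 i j; rewrite card_ord vE' /= /p /=; lra.
  + move=> i j; rewrite vE' (le_trans (shrink_le_dist p c0 i j))// lerDl.
    by rewrite !mulr_ge0 ?invr_ge0.
  + by move=> x; have [i] := us x; rewrite rdistE// lee_fin; exists i.
  + by move=> y; have [i <-] := vs y; exists i; rewrite rdistxx.
- apply: fin_class_bounded => // i j.
  by rewrite (le_trans (shrink_le_dist p c0 i j))//= -lee_fin -rdistE.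
- apply: (@fin_class_prec _ _ q _ (fun i => w i)) => i j.
  apply: (@le_trans _ _ (Num.max 0 (p i j - c))%:E).
    by rewrite lee_fin; exact: shrink_le.
  rewrite EFin_max ge_max edist_ge0/= ltW//.
  by have := uw i j (ltn_ord i) (ltn_ord j); rewrite !inord_val.
Qed.

(** Preceding Y is a condition on infinitely many matrices, but for a space F'
    close to F it already follows from the domination of a single matrix that F
    dominates. *)
Lemma compact_approx F (e : R) : (0 < e)%R ->
  exists N b F', [/\ dominates (GHspace F) N b, dGH F F' <= e%:E
    & forall Y, dominates Y N b -> below Y F'].
Proof.
move=> e0; have e20 : (0 < e / 2)%R by rewrite divr_gt0.
have [n [u us]] := compact_net (@cm_compact _ (GHspace F)) e20.
pose c := (e / n.+1%:R)%R.
have c0 : (0 < c)%R by rewrite divr_gt0.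
have [|F' [FF' _ FY]] := shrunk_net (@cm_finite _ (GHspace F)) (ltW c0)
  (u := u) (s := (e / 2)%R).
  by move=> x; have [i /ltW] := us x; exists i.
exists n.+1, (fun i j => rdist (u (inord i)) (u (inord j)) - c)%R, F'; split=> //.
- exists (fun i => u (inord i)) => i j _ _; rewrite rdistE; last exact: cm_finite.
  by rewrite lte_fin ltrBlDr ltrDl.
- rewrite (le_trans FF')// lee_fin /c (mulrC n.+1%:R) divfK ?pnatr_eq0//; lra.
Qed.

End GHclasses.

(** * The pseudometrics [rhoN] *)

Section RhoN.
Context {R : realType}.
Implicit Types (X Y : emetric R) (F : GH R).

Definition Pbounded X N : set (GH R) := below X `&` GHbounded N N%:R.

Lemma Pbounded_neq0 X m : Pbounded X m.+1 !=set0.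
Proof.
have [x _] := em_nonempty X.
by have [F XF _] := truncated_subspace m (fun=> x); exists F.
Qed.

Lemma rhoN_ge0 m X Y : 0 <= rhoN m.+1 X Y.
Proof. exact: hausdorff_dist_ge0 dGH_ge0 _ _ (Pbounded_neq0 X m). Qed.

Lemma rhoNC N X Y : rhoN N X Y = rhoN N Y X.
Proof. exact: hausdorff_distC dGHC _ _. Qed.

Lemma rhoN_triangle m X Y Z : rhoN m.+1 X Z <= rhoN m.+1 X Y + rhoN m.+1 Y Z.
Proof.
exact: hausdorff_dist_triangle dGH_ge0 _ _ _ (Pbounded_neq0 X m)
  (Pbounded_neq0 Y m) dGH_triangle.
Qed.

Lemma GHbounded_enum F m (D : R) : GHbounded m.+1 D F ->
  exists x : 'I_m.+1 -> GHspace F, forall y, exists i, x i = y.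
Proof.
move=> [/pcard_leP[f] _]; have [x0 _] := em_nonempty (GHspace F).
have f_inj := @inj _ _ _ f.
have fm y : (f y < m.+1)%N by have := @funS _ _ _ _ f y Logic.I.
pose P i y := f y = i :> nat.
exists (fun i => if pselect (exists y, P i y) is left h then sval (cid h) else x0).
move=> y; exists (Ordinal (fm y)); case: pselect => [h|[]]; last by exists y.
by case: cid => z /= zy; apply: f_inj; rewrite ?inE.
Qed.

(** The case of [shrunk_net] in which the net enumerates the whole space. *)
Lemma Pbounded_shrink Y F m (c : R) (x : 'I_m.+1 -> GHspace F) : (0 <= c)%R ->
  GHbounded m.+1 m.+1%:R F -> (forall y, exists i, x i = y) ->
  dominates Y m.+1 (fun i j => rdist (x (inord i)) (x (inord j)) - c)%R ->
  exists2 F', Pbounded Y m.+1 F' & dGH F F' <= (m.+1%:R * c / 2)%:E.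
Proof.
move=> c0 bF xs xY.
have [|F' [FF' bF' YF']] := shrunk_net (@cm_finite _ (GHspace F)) c0 (u := x) (s := 0%R).
  by move=> y; have [i <-] := xs y; exists i; rewrite edistxx.
exists F'; last by rewrite add0r in FF'.
by split; [exact: YF'|apply: bF'; case: bF].
Qed.

Lemma rhoN_le X Y m (c : R) : (0 <= c)%R ->
  (forall F (x : 'I_m.+1 -> GHspace F), Pbounded X m.+1 F ->
    dominates Y m.+1 (fun i j => rdist (x (inord i)) (x (inord j)) - c)%R) ->
  (forall F (x : 'I_m.+1 -> GHspace F), Pbounded Y m.+1 F ->
    dominates X m.+1 (fun i j => rdist (x (inord i)) (x (inord j)) - c)%R) ->
  rhoN m.+1 X Y <= (m.+1%:R * c / 2)%:E.
Proof.
move=> c0 XY YX; apply: hausdorff_dist_le => F PF.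
- have [x xs] := GHbounded_enum PF.2.
  exact: Pbounded_shrink c0 PF.2 xs (XY _ _ PF).
- have [x xs] := GHbounded_enum PF.2.
  have [F' PF' FF'] := Pbounded_shrink c0 PF.2 xs (YX _ _ PF).
  by exists F' => //; rewrite dGHC.
Qed.

(** The truncated subspace of X spanned by u has a counterpart that precedes Y,
    and matching their points costs 2 e. *)
Lemma rhoN_lt_transfer m X Y (e : R) (u : nat -> X) : rhoN m.+1 X Y < e%:E ->
  exists v : nat -> Y, forall i j, (i <= m)%N -> (j <= m)%N ->
    mine (edist (u i) (u j)) m.+1%:R%:E < edist (v i) (v j) + (2 * e)%:E.
Proof.
move=> h; have [F PF [v vE]] := truncated_subspace m u.
have [F' PF' FF'] := hausdorff_dist_ltl h PF.
have [f [+ _ _]] := GHdist_lt_approx FF'.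
set g := fun i => f (v i) => fv.
have /(prec_dominates PF'.1)[w vw] : dominates (GHspace F') m.+1
    (fun i j => rdist (v i) (v j) - 2 * e)%R.
  exists g => i j _ _; rewrite rdistE; last exact: cm_finite.
  by rewrite lte_fin ltrBlDr.
exists w => i j im jm; rewrite -vE// rdistE; last exact: cm_finite.
have := vw i j im jm; case: edist => [r||]//=; last by rewrite addye// ?ltry.
by rewrite -EFinD !lte_fin ltrBlDr.
Qed.

(** Passing from X to Y loses less than 2 e, and shrinking by 2 e costs
    (m + 1) e. *)
Lemma rhoN_GHdist m X Y (e : R) : finite_dist X -> finite_dist Y ->
  GHdist X Y < e%:E -> rhoN m.+1 X Y <= (m.+1%:R * e)%:E.
Proof.
move=> fX fY XYe; have XY0 := GHdist_ge0 X Y.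
have [r /andP[XYr re]] := lt_ereal_dense XYe; rewrite lte_fin in re.
have r0 : (0 < r)%R by rewrite -lte_fin; exact: le_lt_trans XYr.
suff main (A B : emetric R) : finite_dist A -> finite_dist B -> GHdist A B < r%:E ->
    forall F (x : 'I_m.+1 -> GHspace F), Pbounded A m.+1 F ->
    dominates B m.+1 (fun i j => rdist (x (inord i)) (x (inord j)) - 2 * e)%R.
  rewrite (_ : m.+1%:R * e = m.+1%:R * (2 * e) / 2)%R; last by field.
  apply: rhoN_le; [lra|exact: main|].
  by apply: main => //; rewrite GHdistC.
move=> fA fB AB F x [FA _]; apply: (dominates_GHdist fA fB AB).
apply: (prec_dominates FA); exists (fun i => x (inord i)) => i j _ _.
by rewrite (rdistE (@cm_finite _ _)) lte_fin; lra.
Qed.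

Lemma rhoN_ub m X Y : rhoN m.+1 X Y <= m.+1%:R%:E.
Proof.
suff main F F' : Pbounded X m.+1 F -> Pbounded Y m.+1 F' -> dGH F F' <= m.+1%:R%:E.
  have [[F PF] [F' PF']] := (Pbounded_neq0 X m, Pbounded_neq0 Y m).
  by apply: hausdorff_dist_le => G PG; [exists F'|exists F] => //; exact: main.
move=> [_ [_ DF]] [_ [_ DF']].
have [x0 _] := em_nonempty (GHspace F); have [y0 _] := em_nonempty (GHspace F').
rewrite -[m.+1%:R]add0r.
apply: (@GHdist_le _ _ _ unit tt (fun=> x0) (fun=> y0));
  rewrite ?rdistxx ?mulr0 ?addr0//; try exact: cm_finite.
- by move=> x; exists tt; rewrite -lee_fin -rdistE//; exact: cm_finite.
- by move=> x; exists tt; rewrite -lee_fin -rdistE//; exact: cm_finite.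
Qed.

End RhoN.

(** * The metric [rho] *)

Section Rho.
Context {R : realType}.
Implicit Types (X Y Z : emetric R).

Let term_ge0 X Y N : (1 <= N)%N -> 0 <= (2 ^- N)%:E * rhoN N X Y.
Proof.
by case: N => // m _; rewrite mule_ge0 ?rhoN_ge0// lee_fin invr_ge0 exprn_ge0.
Qed.

Lemma rho_ge0 X Y : 0 <= rho X Y.
Proof. by apply: nneseries_ge0 => N N1 _; exact: term_ge0. Qed.

Lemma rhoC X Y : rho X Y = rho Y X.
Proof. by apply: eq_eseriesr => N _; rewrite rhoNC. Qed.

(** All upper bounds on the series rho come from a potential B whose decrements
    dominate its terms. *)
Lemma rho_le_telescope X Y (B : nat -> R) : (forall m, (0 <= B m)%R) ->
  (forall m, (2 ^- m.+1)%:E * rhoN m.+1 X Y <= (B m - B m.+1)%:E) ->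
  rho X Y <= (B 0%N)%:E.
Proof.
move=> B0 XYB; apply: lime_le.
  by apply: is_cvg_nneseries => N N1 _; exact: term_ge0.
apply: nearW => -[|n]; first by rewrite big_geq ?lee_fin.
apply: (@le_trans _ _ (B 0%N - B n)%:E); last by rewrite lee_fin; have := B0 n; lra.
elim: n => [|n IH]; first by rewrite big_geq ?lee_fin ?subrr.
rewrite big_nat_recr//=; apply: le_trans (leeD IH (XYB n)) _.
by rewrite -EFinD lee_fin; lra.
Qed.

(** The tail of the series of [N / 2 ^ N]. *)
(** The sum of N / 2 ^ N over N > m. *)
Definition weight_tail (m : nat) : R := (m.+2%:R * 2 ^- m)%R.

Fact weight_tail_ge0 m : (0 <= weight_tail m)%R.
Proof. by rewrite mulr_ge0// invr_ge0 exprn_ge0. Qed.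

Fact weight_tailB m :
  (weight_tail m - weight_tail m.+1 = 2 ^- m.+1 * m.+1%:R)%R.
Proof.
rewrite /weight_tail exprS invfM.
have -> : (m.+3%:R = m.+1%:R + 2 :> R)%R by rewrite -natrD addn2.
have -> : (m.+2%:R = m.+1%:R + 1 :> R)%R by rewrite -natr1.
set a := (m.+1%:R)%R; set b := (2 ^- m)%R; lra.
Qed.

(** For m = 2 n the value is 2 (n + 1) / 4 ^ n, at most 2 / (n + 1) because
    n + 1 <= 2 ^ n. *)
Fact weight_tail_small (e : R) : (0 < e)%R -> exists m, (weight_tail m < e)%R.
Proof.
move=> e0; have h : \forall n \near \oo, (2 / e < n%:R)%R by exact: nbhs_infty_gtr.
have [n en] := filter_ex h; exists n.*2.
have lt2 : (n.+1%:R <= 2 ^+ n :> R)%R.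
  by rewrite -natrX ler_nat; exact: ltn_expl.
rewrite /weight_tail -addnn exprD.
have -> : ((n + n).+2%:R = 2 * n.+1%:R :> R)%R by rewrite -natrM; congr (_%:R); lia.
set x := (2 ^+ n)%R in lt2 *.
have n0 : (0 < n.+1%:R :> R)%R by [].
have x0 : (0 < x)%R by exact: lt_le_trans lt2.
rewrite ltr_pdivrMr ?mulr_gt0//.
rewrite ltr_pdivrMr// in en.
have nn : (n%:R < n.+1%:R :> R)%R by rewrite ltr_nat.
set k := (n.+1%:R)%R in lt2 n0 nn *.
have ek : (2 < e * k)%R by apply: lt_trans en _; rewrite mulrC ltr_pM2l.
apply: (@lt_le_trans _ _ (e * k * k)%R); first by rewrite ltr_pM2r.
by rewrite -mulrA ler_pM2l// ler_pM// ltW.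
Qed.

Lemma rho_le_rhoN X Y (d : R) n : (0 <= d)%R ->
  (forall m, (m < n)%N -> rhoN m.+1 X Y <= d%:E) ->
  rho X Y <= (d + weight_tail n)%:E.
Proof.
move=> d0 XYd; pose B m := (d * 2 ^- m + weight_tail (maxn m n))%R.
have -> : (d + weight_tail n)%R = B 0%N by rewrite /B max0n expr0 invr1 mulr1.
apply: rho_le_telescope => m.
  by rewrite addr_ge0 ?weight_tail_ge0// mulr_ge0// invr_ge0 exprn_ge0.
have p0 : (0 <= 2 ^- m.+1 :> R)%R by rewrite invr_ge0 exprn_ge0.
have pE : (2 ^- m = 2 * 2 ^- m.+1 :> R)%R.
  by rewrite exprS invfM mulrA divff ?mul1r.
have [mn|nm] := ltnP m n.
- apply: (@le_trans _ _ ((2 ^- m.+1)%:E * d%:E)).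
    by rewrite lee_wpmul2l ?lee_fin// XYd.
  rewrite -EFinM lee_fin /B pE (maxn_idPr mn) (maxn_idPr (ltnW mn)).
  set a := (2 ^- _)%R; nra.
- apply: (@le_trans _ _ ((2 ^- m.+1)%:E * m.+1%:R%:E)).
    by rewrite lee_wpmul2l ?lee_fin// rhoN_ub.
  rewrite -EFinM lee_fin -weight_tailB /B (maxn_idPl nm).
  rewrite (maxn_idPl (leq_trans nm (leqnSn m))) pE.
  set a := (2 ^- _)%R in p0 *; nra.
Qed.

(** Finitely many rho_N control rho, uniformly in the spaces. *)
Lemma rho_small (e : R) : (0 < e)%R -> exists2 d : R, (0 < d)%R & exists n,
  forall X Y, (forall m, (m < n)%N -> rhoN m.+1 X Y <= d%:E) -> rho X Y < e%:E.
Proof.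
move=> e0; have e20 : (0 < e / 2)%R by rewrite divr_gt0.
have [n ne] := weight_tail_small e20; exists (e / 2)%R => //; exists n => X Y h.
by apply: le_lt_trans (rho_le_rhoN (ltW e20) h) _; rewrite lte_fin; lra.
Qed.

Lemma rho_ltry X Y : rho X Y < +oo.
Proof.
have h : rho X Y <= (0 + weight_tail 0)%:E by apply: rho_le_rhoN.
exact: le_lt_trans h (ltry _).
Qed.

Lemma rho_le_linear X Y (e : R) : (0 <= e)%R ->
  (forall m, rhoN m.+1 X Y <= (m.+1%:R * e)%:E) -> rho X Y <= (2 * e)%:E.
Proof.
move=> e0 XYe; pose B m := (weight_tail m * e)%R.
have -> : (2 * e)%R = B 0%N by rewrite /B /weight_tail expr0 invr1 mulr1.
apply: rho_le_telescope => m; first by rewrite mulr_ge0 ?weight_tail_ge0.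
apply: (@le_trans _ _ ((2 ^- m.+1)%:E * (m.+1%:R * e)%:E)).
  by rewrite lee_wpmul2l ?lee_fin ?invr_ge0 ?exprn_ge0.
by rewrite -EFinM lee_fin /B -mulrBl weight_tailB mulrA.
Qed.

Lemma rhoN_le_rho X Y m : (2 ^- m.+1)%:E * rhoN m.+1 X Y <= rho X Y.
Proof.
apply: (@le_trans _ _ (\sum_(1 <= N < m.+2) ((2 ^- N)%:E * rhoN N X Y))).
  rewrite big_nat_recr//= leeDr// big_nat_cond sume_ge0// => N.
  by rewrite andbT => /andP[N1 _]; exact: term_ge0.
by apply: nneseries_lim_ge => N N1 _; exact: term_ge0.
Qed.

Lemma rho_lt_rhoN X Y m (e : R) :
  rho X Y < (2 ^- m.+1 * e)%:E -> rhoN m.+1 X Y < e%:E.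
Proof.
by move=> /(le_lt_trans (rhoN_le_rho X Y m)); rewrite EFinM lte_pmul2l.
Qed.

Lemma rho_triangle X Y Z : rho X Z <= rho X Y + rho Y Z.
Proof.
rewrite /rho -nneseriesD; try by move=> N N1 _; exact: term_ge0.
apply: lee_lim.
- by apply: is_cvg_nneseries => N N1 _; exact: term_ge0.
- by apply: is_cvg_nneseries => N N1 _; rewrite adde_ge0// term_ge0.
- apply: nearW => n; rewrite big_nat_cond [leRHS]big_nat_cond.
  apply: lee_sum => -[|m]// _; rewrite -ge0_muleDr ?rhoN_ge0//.
  by rewrite lee_wpmul2l ?rhoN_triangle// lee_fin invr_ge0 exprn_ge0.
Qed.

(** Taking m above the entries of b removes the truncation from
    [rhoN_lt_transfer]; m depends on b only, not on the spaces. *)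
Lemma dominates_rhoN N (b : nat -> nat -> R) (e : R) :
  exists m, forall X Y, rhoN m.+1 X Y < e%:E ->
    dominates X N (fun i j => b i j + 2 * e)%R -> dominates Y N b.
Proof.
have : \forall m \near \oo, forall p : 'I_N * 'I_N,
    (b p.1 p.2 + 2 * e < m%:R)%R.
  by apply: filter_forall => p; exact: nbhs_infty_gtr.
move=> h; near \oo => m.
have bm : forall p : 'I_N * 'I_N, (b p.1 p.2 + 2 * e < m%:R)%R by near: m.
have Nm : (N <= m)%N by near: m; exact: nbhs_infty_ge.
exists m => X Y XY [u bu]; have [v uv] := rhoN_lt_transfer u XY.
exists v => i j iN jN.
have := uv i j (leq_trans (ltnW iN) Nm) (leq_trans (ltnW jN) Nm).
have /lt_trans : (b i j + 2 * e)%:E < mine (edist (u i) (u j)) m.+1%:R%:E.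
  rewrite lt_min bu//= lte_fin (lt_le_trans (bm (Ordinal iN, Ordinal jN)))//.
  by rewrite ler_nat.
move=> /[apply]; case: edist => [r||]//=; last by rewrite ?ltry.
by rewrite -EFinD !lte_fin ltrD2r.
Unshelve. all: by end_near. Qed.

Lemma rhoN_eq0_prec X Y : (forall m, rhoN m.+1 X Y = 0) -> prec X Y.
Proof.
move=> XY0; apply/precP => N b /dominates_open[e e0 Xb].
have [m] := dominates_rhoN N b (e / 2); apply; last first.
  by apply: dominates_le Xb => i j _ _; lra.
by rewrite XY0 lte_fin divr_gt0.
Qed.

Lemma rho_eq0 X Y : rho X Y = 0 <-> equivalent X Y.
Proof.
split=> [XY0|XY].
  have h m : rhoN m.+1 X Y = 0.
    apply/eqP; rewrite eq_le rhoN_ge0 andbT.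
    apply/lee_addgt0Pr => e e0; rewrite add0e ltW//; apply: (rho_lt_rhoN (e := e)).
    by rewrite XY0 lte_fin mulr_gt0// invr_gt0 exprn_gt0.
  by split; apply: rhoN_eq0_prec => // m; rewrite rhoNC.
apply/eqP; rewrite eq_le rho_ge0 andbT.
apply/lee_addgt0Pr => e e0; rewrite add0e.
have [d d0 [n +]] := rho_small e0; move=> /(_ X Y) h; apply: ltW; apply: h => m _.
rewrite /rhoN (below_equivalent XY).
by apply: hausdorff_dist_le => F FX; exists F; rewrite ?dGHxx ?lee_fin// ltW.
Qed.

End Rho.

Section Mrho.
Context {R : realType}.
Implicit Types (x y : Mquot R).

Lemma Mclass_repr x : Mclass (repr x) = x.
Proof. by rewrite /Mclass reprK. Qed.

Lemma Mrho_ge0 x y : 0 <= Mrho x y.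
Proof. exact: rho_ge0. Qed.

Lemma Mrho_eq0 x y : Mrho x y = 0 <-> x = y.
Proof.
rewrite -{2}(Mclass_repr x) -{2}(Mclass_repr y).
by split=> [/rho_eq0/Mclass_eq|/Mclass_eq/rho_eq0].
Qed.

Lemma Mrhoxx x : Mrho x x = 0.
Proof. exact/Mrho_eq0. Qed.

Lemma MrhoC x y : Mrho x y = Mrho y x.
Proof. exact: rhoC. Qed.

Lemma Mrho_triangle x y z : Mrho x z <= Mrho x y + Mrho y z.
Proof. exact: rho_triangle. Qed.

Lemma Mrho_is_metric : is_metric (@Mrho R).
Proof.
split; [|exact: Mrho_eq0|exact: MrhoC|exact: Mrho_triangle].
by move=> x y; rewrite Mrho_ge0 rho_ltry.
Qed.

End Mrho.

(** * Ultraproducts *)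

Section Ultraproduct.
Context {R : realType} (I : Type) (w : set_system I) (Uw : UltraFilter w).
Variable X : I -> emetric R.

(** Ultraproducts are used through this description, which applies to
    ultralimits of sequences as well as to families with other index types. *)
Definition is_ultraproduct (U : emetric R) : Prop :=
  exists2 f : (forall i, X i) -> U,
    forall p, exists x, f x = p
    & forall x y, edist (f x) (f y) = lim ((fun i => edist (x i) (y i)) @ w).

Let pw : ProperFilter w := @ultra_proper I w Uw.

Lemma ultra_lim_lt (f : I -> \bar R) (a : \bar R) :
  a < lim (f @ w) -> w [set i | a < f i].
Proof.
move=> af; have [//|nw] := in_ultra_setVsetC [set i | a < f i] Uw.
suff : lim (f @ w) <= a by rewrite leNgt af.
apply: lime_le; first exact: ultra_cvg_ereal.
by apply: filterS nw => i /negP; rewrite -leNgt.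
Qed.

Lemma ultra_lim_gt (f : I -> \bar R) (a : \bar R) :
  lim (f @ w) < a -> w [set i | f i < a].
Proof.
move=> fa; have [//|nw] := in_ultra_setVsetC [set i | f i < a] Uw.
suff : a <= lim (f @ w) by rewrite leNgt fa.
apply: lime_ge; first exact: ultra_cvg_ereal.
by apply: filterS nw => i /negP; rewrite -leNgt.
Qed.

Lemma ultraproduct_dominates U N (b : nat -> nat -> R) : is_ultraproduct U ->
  dominates U N b -> w [set i | dominates (X i) N b].
Proof.
move=> [f /choice[g fK] fE] [u bu].
have : \forall i \near w, forall p : 'I_N * 'I_N,
    (b p.1 p.2)%:E < edist (g (u p.1) i) (g (u p.2) i).
  apply: filter_forall => p; apply: ultra_lim_lt; rewrite -fE !fK.
  exact: bu.
apply: filterS => i bi; exists (fun n => g (u n) i) => k l kN lN.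
exact: (bi (Ordinal kN, Ordinal lN)).
Qed.

(** The loss e is necessary: a strict inequality becomes weak in the limit. *)
Lemma dominates_ultraproduct U N (b : nat -> nat -> R) (e : R) :
  is_ultraproduct U -> (0 < e)%R -> w [set i | dominates (X i) N b] ->
  dominates U N (fun i j => b i j - e)%R.
Proof.
move=> [f _ fE] e0 wb.
have h i : exists u : nat -> X i, dominates (X i) N b ->
    forall k l, (k < N)%N -> (l < N)%N -> (b k l)%:E < edist (u k) (u l).
  have [[u bu]|nb] := pselect (dominates (X i) N b); first by exists u.
  by have [x _] := em_nonempty (X i); exists (fun=> x).
pose g i := sval (cid (h i)); have gb i := svalP (cid (h i)).
exists (fun k => f (fun i => g i k)) => k l kN lN; rewrite fE.
apply: (@lt_le_trans _ _ (b k l)%:E); first by rewrite lte_fin ltrBlDr ltrDl.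
apply: lime_ge; first exact: ultra_cvg_ereal.
by apply: filterS wb => i /gb bg; apply: ltW; exact: bg.
Qed.

(** Up to an error h, distance matrices of spaces in H(m + 1, m + 1) take
    finitely many values, so almost every factor dominates the same grid
    matrices as U up to h. Together with the rounding this amounts to shrinking
    by 3 h. *)
Lemma ultraproduct_rhoN U m (e : R) : is_ultraproduct U -> (0 < e)%R ->
  w [set i | rhoN m.+1 (X i) U <= e%:E].
Proof.
move=> UX e0.
pose h : R := (e / (2 * m.+1%:R))%R.
have h0 : (0 < h)%R by rewrite divr_gt0// mulr_gt0.
have [K hK] : exists K : nat, (m.+1%:R / h < K%:R)%R.
  by apply: (@filter_ex _ \oo); exact: nbhs_infty_gtr.
pose B (g : {ffun 'I_m.+1 * 'I_m.+1 -> 'I_K}) (i j : nat) : R :=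
  (h * (val (g (inord i, inord j)))%:R - h)%R.
have w1 : \forall i \near w, forall g,
    dominates U m.+1 (B g) -> dominates (X i) m.+1 (B g).
  apply: filter_forall => g; have [Ug|nUg] := pselect (dominates U m.+1 (B g)).
    by apply: filterS (ultraproduct_dominates UX Ug) => i.
  by apply: nearW.
have w2 : \forall i \near w, forall g, dominates (X i) m.+1 (B g) ->
    dominates U m.+1 (fun k l => B g k l - h)%R.
  apply: filter_forall => g.
  have [Xg|nXg] := in_ultra_setVsetC [set i | dominates (X i) m.+1 (B g)] Uw.
    by apply: nearW => i _; exact: dominates_ultraproduct Xg.
  by apply: filterS nXg => i /= nXi /nXi.
have grid F (x : 'I_m.+1 -> GHspace F) : GHbounded m.+1 m.+1%:R F ->
    exists2 g, dominates (GHspace F) m.+1 (B g) &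
      forall i j, (rdist (x (inord i)) (x (inord j)) - 3 * h <= B g i j - h)%R.
  move=> [_ DF]; pose D i j := rdist (x i) (x j).
  have D0 i j : (0 <= D i j / h)%R by rewrite divr_ge0 ?rdist_ge0// ltW.
  have DK i j : (Num.truncn (D i j / h) < K)%N.
    rewrite -(ltr_nat R); apply: le_lt_trans hK.
    have /andP[le _] := truncn_itv (D0 i j); apply: le_trans le _.
    rewrite ler_pM2r ?invr_gt0// -lee_fin -rdistE//; exact: cm_finite.
  exists [ffun p => Ordinal (DK p.1 p.2)]; last first.
    move=> i j; rewrite /B ffunE /= -/(D _ _).
    have /andP[_] := truncn_itv (D0 (inord i) (inord j)).
    by rewrite ltr_pdivrMr// -addn1 natrD mulrDl mul1r [(_ * h)%R]mulrC; lra.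
  exists (fun i => x (inord i)) => i j _ _; rewrite rdistE; last exact: cm_finite.
  rewrite /B ffunE /= -/(D _ _) lte_fin.
  have /andP[+ _] := truncn_itv (D0 (inord i) (inord j)).
  by rewrite ler_pdivlMr// [(_ * h)%R]mulrC; lra.
have eE : (m.+1%:R * (3 * h) / 2 <= e)%R.
  rewrite /h [leLHS](_ : _ = 3 / 4 * e)%R; first lra.
  have : (m.+1%:R != 0 :> R)%R by rewrite pnatr_eq0.
  by move: (m.+1%:R : R)%R => k k0; field.
near=> i; apply: (@le_trans _ _ (m.+1%:R * (3 * h) / 2)%:E); rewrite ?lee_fin//.
have h30 : (0 <= 3 * h)%R by lra.
have i1 : forall g, dominates U m.+1 (B g) -> dominates (X i) m.+1 (B g).
  by near: i.
have i2 : forall g, dominates (X i) m.+1 (B g) ->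
    dominates U m.+1 (fun k l => B g k l - h)%R by near: i.
apply: rhoN_le => // F x [FX bF]; have [g Fg gh] := grid F x bF;
  have Xg := prec_dominates FX Fg.
- by apply: dominates_le (i2 g Xg) => k l _ _; exact: gh.
- apply: dominates_le (i1 g Xg) => k l _ _; apply: le_trans (gh k l) _.
  by rewrite gerBl ltW.
Unshelve. all: by end_near. Qed.

End Ultraproduct.

Section UltraproductExists.
Context {R : realType} (I : Type) (w : set_system I) (Uw : UltraFilter w).
Variable X : I -> emetric R.

Let uprod_dist (x y : forall i, X i) : \bar R :=
  lim ((fun i => edist (x i) (y i)) @ w).

Let uprod_dist_ge0 x y : 0 <= uprod_dist x y.
Proof.
have pw := @ultra_proper _ _ Uw.
by apply: lime_ge; [exact: ultra_cvg_ereal|apply: nearW => i; exact: edist_ge0].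
Qed.

Let uprod_distxx x : uprod_dist x x = 0.
Proof.
have pw := @ultra_proper _ _ Uw; rewrite /uprod_dist (_ : (fun _ => _) = cst 0) ?lim_cst//.
by apply/funext => n; apply/edist_eq0.
Qed.

Let uprod_distC x y : uprod_dist x y = uprod_dist y x.
Proof.
by rewrite /uprod_dist; congr (lim (_ @ w)); apply/funext => n; rewrite edistC.
Qed.

Let uprod_dist_triangle x y z :
  uprod_dist x z <= uprod_dist x y + uprod_dist y z.
Proof.
have pw := @ultra_proper _ _ Uw.
apply: le_add_of_lt_fin; rewrite ?uprod_dist_ge0// => r s.
move=> /(ultra_lim_gt Uw) xy /(ultra_lim_gt Uw) yz.
apply: lime_le; first exact: ultra_cvg_ereal.
apply: filterS2 xy yz => i xy yz.
by apply: le_trans (edist_triangle _ (y i) _) _; rewrite EFinD leeD// ltW.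
Qed.

Lemma exists_ultraproduct : exists U, is_ultraproduct w X U.
Proof.
have ne : [set: forall i, X i] !=set0.
  by exists (fun i => sval (cid (em_nonempty (X i)))).
exists (zero_quotient uprod_dist_ge0 uprod_distxx uprod_distC uprod_dist_triangle ne).
exists (@zpi R _ uprod_dist); first by move=> p; exists (zrepr p); exact: zreprK.
exact: zdist_pi uprod_dist_ge0 uprod_distxx uprod_distC uprod_dist_triangle.
Qed.

End UltraproductExists.

Section Compactness.
Context {R : realType}.

Lemma ultralimit_ultraproduct (w : set_system nat) (Uw : UltraFilter w)
  (X : nat -> emetric R) : is_ultraproduct w X (ultralimit Uw X).
Proof.
exists (@zpi R _ (@udist R w X)); first by move=> p; exists (zrepr p); exact: zreprK.
move=> x y; exact: (zdist_pi (@udist_ge0 R w Uw X) (@udistxx R w Uw X)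
  (@udistC R w X) (@udist_triangle R w Uw X)).
Qed.

(** Maximality holds because, for each set, its preimage or that of its
    complement belongs to F. *)
Lemma ultra_fmap (S T : Type) (f : S -> T) (F : set_system S) :
  UltraFilter F -> UltraFilter (f @ F).
Proof.
move=> UF; have pF := @ultra_proper _ _ UF; split; first exact: fmap_proper_filter.
move=> G pG FG; apply/seteqP; split=> // A GA.
have [//|nA] := in_ultra_setVsetC (f @^-1` A) UF.
have /FG GnA : (f @ F) (~` A) by [].
by have [x [Ax /(_ Ax)]] := filter_ex (filterI GA GnA).
Qed.

(** The domination data of a class, as an element of a type that is small
    enough to index an ultraproduct. *)
(** An ultraproduct cannot be indexed by the classes themselves, which form a
    larger universe than the carriers of spaces. A class is determined by the
    matrices that it dominates, and sets of matrices are small. *)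
Definition profile : Type := nat -> (nat -> nat -> R) -> Prop.

Definition Mprofile (x : Mquot R) : profile := dominates (repr x).

Lemma Mprofile_inj : injective Mprofile.
Proof.
move=> x y xy; rewrite -(Mclass_repr x) -(Mclass_repr y); apply/Mclass_eq.
by split; apply/precP => N b; rewrite -!/(Mprofile _ _ _) xy.
Qed.

Lemma Mquot_compact : compact [set: dtop (@Mrho R)].
Proof.
rewrite compact_ultra => F UF _; have pF := @ultra_proper _ _ UF.
have [x0 _] := filter_ex (filterT (F := F)).
have /choice[r rK] (t : profile) :
    exists x : Mquot R, forall y, Mprofile y = t -> x = y.
  have [[x <-]|nx] := pselect (exists x, Mprofile x = t).
    by exists x => y /Mprofile_inj.
  by exists x0 => y yt; exfalso; apply: nx; exists y.
have Uw := ultra_fmap Mprofile UF.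
have [U UX] := exists_ultraproduct Uw (fun t => repr (r t)).
exists (Mclass U); split=> // A mA.
have [e e0 eA] := dtop_nbhs_sub mA; apply: (filterS eA).
have [d d0 [n small]] := rho_small e0.
have : \forall t \near Mprofile @ F, forall m : 'I_n,
    rhoN m.+1 (repr (r t)) U <= d%:E.
  by apply: filter_forall => m; exact: ultraproduct_rhoN.
apply: (@filterS _ F) => x /= h.
rewrite -(Mclass_repr x) Mrho_class rhoC.
by apply: small => m mn; have := h (Ordinal mn); rewrite (rK _ x).
Qed.

End Compactness.

(** * The Gromov-Hausdorff space in the space of classes *)

Section CompactIsometric.
Context {R : realType}.

Lemma compact_ultra_lim (X : emetric R) (cX : compact [set: dtop (@edist R X)])
    (I : Type) (w : set_system I) (Uw : UltraFilter w) (u : I -> X) :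
  exists x, forall e : R, (0 < e)%R -> w [set i | edist x (u i) < e%:E].
Proof.
have Uu := ultra_fmap (u : I -> dtop (@edist R X)) Uw.
have pw := @ultra_proper _ _ Uw.
move: cX; rewrite compact_ultra => /(_ _ Uu)[|x [_ ux]].
  exact: filterT.
exists x => e e0; apply: (ux [set y | edist x y < e%:E]).
exact: dtop_nbhs_ball (@edist_ge0 _ _) (@edistxx _ _) (@edist_triangle _ _) _ _ e0.
Qed.

(** The pointwise ultralimit of almost isometric maps preserves distances. It
    is onto since each y is the image of a limit of almost preimages of y. *)
Lemma GHdist0_isometric (X Y : cmetric R) :
  (forall e : R, (0 < e)%R -> GHdist X Y < e%:E) -> isometric X Y.
Proof.
move=> XY; have fX := @cm_finite _ X; have fY := @cm_finite _ Y.
have [eps [eps0 epsP]] : exists eps : nat -> R, (forall n, (0 < eps n)%R) /\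
    forall e : R, (0 < e)%R -> \forall n \near \oo, (eps n < e)%R.
  exists (fun n => n.+1%:R^-1)%R; split=> // e e0.
  exact: (near_infty_natSinv_lt (PosNum e0)).
have /choice[f fP] n := GHdist_lt_approx (XY _ (eps0 n)).
have [w [Uw wP]] := ultraFilterLemma (F := \oo) _.
have pw := @ultra_proper _ _ Uw.
have small (e : R) : (0 < e)%R -> w [set n | (2 * eps n < e)%R].
  move=> e0; have e20 : (0 < e / 2)%R by rewrite divr_gt0.
  by apply: wP; apply: filterS (epsP _ e20) => n /=; lra.
have lim (u : nat -> Y) : exists y, forall e : R, (0 < e)%R ->
    w [set n | (rdist y (u n) < e)%R].
  have [y yu] := compact_ultra_lim (@cm_compact _ Y) Uw u; exists y => e e0.
  by apply: filterS (yu e e0) => n /=; rewrite (rdistE fY).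
have /choice[g gP] x := lim (fun n => f n x).
have giso x x' : rdist (g x) (g x') = rdist x x'.
  apply/eqP; rewrite eq_le; apply/andP; split; apply/ler_addgt0Pr => e e0;
    have e30 : (0 < e / 3)%R by rewrite divr_gt0.
  - have [n [[ne nx] nx']] := filter_ex (filterI (filterI (small _ e30)
      (gP x _ e30)) (gP x' _ e30)).
    have [_ + _] := fP n; move=> /(_ x x').
    have := rdist_triangle fY (g x) (f n x) (g x').
    have := rdist_triangle fY (f n x) (f n x') (g x').
    by rewrite /= in ne nx nx'; rewrite (rdistC (f n x')); lra.
  - have [n [[ne nx] nx']] := filter_ex (filterI (filterI (small _ e30)
      (gP x _ e30)) (gP x' _ e30)).
    have [+ _ _] := fP n; move=> /(_ x x').
    have := rdist_triangle fY (f n x) (g x) (f n x').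
    have := rdist_triangle fY (g x) (g x') (f n x').
    by rewrite /= in ne nx nx'; rewrite (rdistC (f n x) (g x)); lra.
have gsurj y : exists x, g x = y.
  have /choice[a aP] n : exists x, (rdist (f n x) y < 2 * eps n)%R.
    by have [_ _ /(_ y)] := fP n.
  have [x xa] := compact_ultra_lim (@cm_compact _ X) Uw a; exists x.
  apply/edist_eq0; rewrite (rdistE fY); congr _%:E.
  apply/eqP; rewrite eq_le rdist_ge0 andbT; apply/ler_addgt0Pr => e e0.
  rewrite add0r; have e40 : (0 < e / 4)%R by rewrite divr_gt0.
  have [n [[ne nx] nxa]] := filter_ex (filterI (filterI (small _ e40)
    (gP x _ e40)) (xa _ e40)).
  rewrite /= (rdistE fX) lte_fin in nxa.
  have [_ + _] := fP n; move=> /(_ x (a n)); have := aP n.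
  have := rdist_triangle fY (g x) (f n x) y.
  have := rdist_triangle fY (f n x) (f n (a n)) y.
  by rewrite /= in ne nx; lra.
exists g; first by move=> x x'; rewrite (rdistE fX) (rdistE fY) giso.
have /choice[h hK] := gsurj; exists h => // x; apply/edist_eq0.
by rewrite (rdistE fX) -giso hK rdistxx.
Qed.

End CompactIsometric.

Section NearCompact.
Context {R : realType}.

(** Dominating this matrix means having N points at mutual distances > e. *)
Let sep_matrix (e : R) (i j : nat) : R := if i == j then (-1)%R else e.

Definition separated (X : emetric R) (e : R) N : Prop :=
  dominates X N (sep_matrix e).

Fact separatedI (X : emetric R) (e : R) N (u : nat -> X) :
  (forall i j, (i < N)%N -> (j < N)%N -> i != j -> e%:E < edist (u i) (u j)) ->
  separated X e N.
Proof.
move=> eu; exists u => i j iN jN; rewrite /sep_matrix; case: eqVneq => [->|ij].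
  by rewrite edistxx lte_fin ltrN10.
exact: eu.
Qed.

Fact separated_bound (X : cmetric R) (e : R) : (0 < e)%R ->
  exists K, forall N, separated X e N -> (N <= K)%N.
Proof.
move=> e0; have e20 : (0 < e / 2)%R by rewrite divr_gt0.
have [n [u /choice[k ku]]] := compact_net (@cm_compact _ X) e20.
exists n.+1 => N [x ex].
have : injective (fun i : 'I_N => k (x i)).
  move=> i j kij; apply/eqP/negPn/negP => ij.
  have := ex i j (ltn_ord i) (ltn_ord j); rewrite /sep_matrix.
  have -> : (i == j :> nat) = false by apply/negbTE.
  have := rdist_triangle (@cm_finite _ X) (x i) (u (k (x i))) (x j).
  have := ku (x i); have := ku (x j); rewrite -kij !(rdistE (@cm_finite _ X)) !lte_fin.
  by rewrite (rdistC (x j)); lra.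
by move/leq_card; rewrite !card_ord.
Qed.

Fact max_separated (X : cmetric R) (e : R) : (0 < e)%R ->
  exists N, separated X e N /\ ~ separated X e N.+1.
Proof.
move=> e0; have [K hK] := separated_bound X e0.
have ex : exists N, `[< separated X e N >].
  have [x _] := em_nonempty X.
  by exists 0%N; apply/asboolP; exists (fun=> x).
have ub N : `[< separated X e N >] -> (N <= K)%N by move/asboolP; exact: hK.
case: (ex_maxnP ex ub) => N /asboolP sN maxN; exists N; split=> //.
by move/asboolP/maxN; rewrite ltnn.
Qed.

Fact separated_cover (X : emetric R) (e s : R) N (u : nat -> X) :
  (e <= s)%R ->
  (forall i j, (i < N)%N -> (j < N)%N -> i != j -> e%:E < edist (u i) (u j)) ->
  ~ separated X e N.+1 -> forall x, exists2 i, (i < N)%N & edist x (u i) <= s%:E.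
Proof.
move=> es eu nsep x; apply: contrapT => nx; apply: nsep.
have ex i : (i < N)%N -> e%:E < edist x (u i).
  move=> iN; rewrite ltNge; apply/negP => xe; apply: nx; exists i => //.
  by rewrite (le_trans xe)// lee_fin.
apply: (@separatedI _ _ _ (fun i => if (i < N)%N then u i else x)) => i j iN jN ij.
have [iN'|iN'] := ltnP i N; have [jN'|jN'] := ltnP j N.
- exact: eu.
- by rewrite edistC ex.
- exact: ex.
- by move: ij; rewrite (_ : i = j) ?eqxx//; lia.
Qed.

Fact compact_diam (X : cmetric R) : exists D, forall x y : X, (rdist x y <= D)%R.
Proof.
have [n [u /choice[k ku]]] := compact_net (@cm_compact _ X) (@ltr01 R).
exists (2 + \sum_(p : 'I_n.+1 * 'I_n.+1) rdist (u p.1) (u p.2))%R => x y.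
have fX := @cm_finite _ X.
have : (rdist (u (k x)) (u (k y)) <=
    \sum_(p : 'I_n.+1 * 'I_n.+1) rdist (u p.1) (u p.2))%R.
  rewrite (bigD1 (k x, k y))//= lerDl sumr_ge0// => p _; exact: rdist_ge0.
have := ku x; have := ku y; rewrite !(rdistE fX) !lte_fin.
have := rdist_triangle fX x (u (k x)) y.
have := rdist_triangle fX (u (k x)) (u (k y)) y.
by rewrite (rdistC y (u (k y))); lra.
Qed.

(** The supremum of the sums of distances need not be attained, because
    separation is an open condition. *)
Fact near_max_separated (X : cmetric R) (e c : R) N : (0 < c)%R ->
  separated X e N ->
  exists2 u : nat -> X,
    forall i j, (i < N)%N -> (j < N)%N -> (sep_matrix e i j)%:E < edist (u i) (u j) &
    forall v : nat -> X,
      (forall i j, (i < N)%N -> (j < N)%N -> (sep_matrix e i j)%:E < edist (v i) (v j)) ->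
      (\sum_(p : 'I_N * 'I_N) rdist (v p.1) (v p.2) <=
       \sum_(p : 'I_N * 'I_N) rdist (u p.1) (u p.2) + c)%R.
Proof.
move=> c0 [u0 u0e]; have [D XD] := compact_diam X.
pose S (u : nat -> X) := (\sum_(p : 'I_N * 'I_N) rdist (u p.1) (u p.2))%R.
pose A := [set S u | u in [set u : nat -> X |
  forall i j, (i < N)%N -> (j < N)%N -> (sep_matrix e i j)%:E < edist (u i) (u j)]].
have supA : has_sup A.
  split; first by exists (S u0), u0.
  exists (\sum_(p : 'I_N * 'I_N) D)%R => _ [u _ <-]; apply: ler_sum => p _; exact: XD.
have [_ [u ue <-] Au] := sup_adherent c0 supA; exists u => // v ve.
have := sup_upper_bound supA (ex_intro2 _ _ v ve erefl).
by rewrite -!/(S _); lra.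
Qed.

(** Write u for the separated tuple of X, y for its copy in Y, and x for the
    copy of y in X. Distances drop by at most 2 c at each transfer, so x is
    still separated and no distance of x drops by more than 4 c below that of
    u; as the sum of distances of x exceeds that of u by at most e / 2, no
    single distance can grow much. A point of Y far from y would, carried to X
    along with y, give one more separated point. *)
Lemma compact_rhoN_GHdist (X : cmetric R) (e : R) : (0 < e)%R ->
  exists m, exists2 c : R, (0 < c)%R &
    forall Y : emetric R, finite_dist Y -> rhoN m.+1 X Y < c%:E ->
      GHdist X Y <= (3 * e)%:E.
Proof.
move=> e0; have fX := @cm_finite _ X; have [D XD] := compact_diam X.
have [N [sN nsN]] := max_separated X e0.
have e20 : (0 < e / 2)%R by rewrite divr_gt0.
have [u ue umax] := near_max_separated e20 sN.
have [g g0 ug] := lt_edist_open ue.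
pose q : R := (4 * (#|{: 'I_N * 'I_N}|)%:R + 2)%R.
have q0 : (0 < q)%R by rewrite ltr_pwDr// mulr_ge0.
(* c <= g / 8 keeps tuples separated after two transfers, and c q <= e / 2
   absorbs the loss of 4 c in each distance, summed over all pairs *)
pose c : R := (Num.min (g / 8) (Num.min (e / 8) (e / (2 * q))))%R.
have c0 : (0 < c)%R by rewrite !lt_min !divr_gt0// mulr_gt0.
have [cg ce cq] : [/\ c <= g / 8, c <= e / 8 & c * q <= e / 2]%R.
  split; rewrite ?ge_min ?lexx ?orbT//.
  by rewrite -ler_pdivlMr// -mulrA -invfM !ge_min lexx !orbT.
have [m [mN mD]] : exists m, (N <= m)%N /\ (D + e + 1 < m%:R)%R.
  near \oo => m; exists m; split; near: m; first exact: nbhs_infty_ge.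
  exact: nbhs_infty_gtr.
have mD' : (D + e + 1 < m.+1%:R)%R by apply: lt_trans mD _; rewrite ltr_nat.
exists m; exists c => // Y fY XY.
(* tuples are carried from X to Y and back with a loss below 2 c; truncation at
   m + 1 has no effect because it exceeds the diameter of X by more than 2 c *)
have fwd (a : nat -> X) : exists b : nat -> Y, forall i j, (i <= m)%N -> (j <= m)%N ->
    (rdist (a i) (a j) < rdist (b i) (b j) + 2 * c)%R.
  have [b ab] := rhoN_lt_transfer a XY; exists b => i j im jm.
  have := ab i j im jm; rewrite (rdistE fX) (rdistE fY) -EFin_min -EFinD lte_fin.
  by rewrite min_l//; have := XD (a i) (a j); lra.
have bwd (b : nat -> Y) : exists a : nat -> X, forall i j, (i <= m)%N -> (j <= m)%N ->
    (rdist (b i) (b j) < rdist (a i) (a j) + 2 * c)%R.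
  have YX : rhoN m.+1 Y X < c%:E by rewrite rhoNC.
  have [a ba] := rhoN_lt_transfer b YX; exists a => i j im jm.
  have := ba i j im jm; rewrite (rdistE fX) (rdistE fY) -EFin_min -EFinD lte_fin.
  by rewrite gt_min => /orP[//|]; have := XD (a i) (a j); lra.
have lt_m i : (i < N)%N -> (i <= m)%N by move=> iN; exact: leq_trans (ltnW iN) mN.
have sepE i j : i != j -> sep_matrix e i j = e by rewrite /sep_matrix => /negbTE ->.
have ug' i j : (i < N)%N -> (j < N)%N -> i != j -> (e + g < rdist (u i) (u j))%R.
  by move=> iN jN ij; have := ug i j iN jN; rewrite sepE// (rdistE fX).
have [y uy] := fwd u; have [x yx] := bwd y.
have xsum : (\sum_(p : 'I_N * 'I_N) rdist (x p.1) (x p.2) <=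
    \sum_(p : 'I_N * 'I_N) rdist (u p.1) (u p.2) + e / 2)%R.
  apply: umax => i j iN jN; rewrite /sep_matrix; case: eqVneq => [->|ij].
    by rewrite edistxx lte_fin ltrN10.
  rewrite (rdistE fX) lte_fin; have := ug' i j iN jN ij.
  have := uy i j (lt_m i iN) (lt_m j jN); have := yx i j (lt_m i iN) (lt_m j jN).
  lra.
have xu (i j : 'I_N) : (rdist (x i) (x j) - rdist (u i) (u j) <=
    e / 2 + 4 * c * (#|{: 'I_N * 'I_N}|)%:R)%R.
  have low (p : 'I_N * 'I_N) :
      (- (4 * c) <= rdist (x p.1) (x p.2) - rdist (u p.1) (u p.2))%R.
    have := uy p.1 p.2 (lt_m _ (ltn_ord _)) (lt_m _ (ltn_ord _)).
    have := yx p.1 p.2 (lt_m _ (ltn_ord _)) (lt_m _ (ltn_ord _)); lra.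
  have : (\sum_(p : 'I_N * 'I_N)
      (rdist (x p.1) (x p.2) - rdist (u p.1) (u p.2) + 4 * c) <=
      e / 2 + 4 * c * (#|{: 'I_N * 'I_N}|)%:R)%R.
    rewrite big_split /= sumrB sumr_const mulr_natr lerD2r; lra.
  apply: le_trans; rewrite (bigD1 (i, j))//= -[leLHS]addr0 lerD//; first lra.
  by apply: sumr_ge0 => p _; have := low p; lra.
have yu (i j : 'I_N) : (rdist (y i) (y j) <= rdist (u i) (u j) + 2 * (e / 2))%R.
  have := yx i j (lt_m _ (ltn_ord _)) (lt_m _ (ltn_ord _)); have := xu i j.
  by move: cq; rewrite /q; set k := (_%:R)%R; nra.
have uy' (i j : 'I_N) : (rdist (u i) (u j) <= rdist (y i) (y j) + 2 * (e / 2))%R.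
  have := uy i j (lt_m _ (ltn_ord _)) (lt_m _ (ltn_ord _)); lra.
have ux : forall z : X, exists2 i, (i < N)%N & edist z (u i) <= (2 * e)%:E.
  apply: (@separated_cover X e) => //; first lra.
  by move=> i j iN jN ij; rewrite (rdistE fX) lte_fin; have := ug' i j iN jN ij; lra.
have yY : forall z : Y, exists2 i, (i < N)%N & edist z (y i) <= (2 * e)%:E.
  apply: (@separated_cover Y (e + 4 * c)); first lra.
    move=> i j iN jN ij; rewrite (rdistE fY) lte_fin; have := ug' i j iN jN ij.
    have := uy i j (lt_m i iN) (lt_m j jN); lra.
  move=> [b be]; apply: nsN; have [a ba] := bwd b.
  apply: (@separatedI _ _ _ a) => i j iN jN ij.
  have := be i j iN jN; rewrite /sep_matrix (negbTE ij) (rdistE fX) (rdistE fY).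
  have := ba i j (leq_trans (iN : (i <= N)%N) mN) (leq_trans (jN : (j <= N)%N) mN).
  rewrite !lte_fin; lra.
have [x0 _] := em_nonempty X; have [i0 i0N _] := ux x0.
apply: (@le_trans _ _ (e / 2 + 2 * e)%:E); last by rewrite lee_fin; lra.
apply: (@GHdist_le _ _ _ _ (Ordinal i0N) (fun i : 'I_N => u i) (fun i : 'I_N => y i)) => //.
- move=> z; have [i iN] := ux z; rewrite (rdistE fX) lee_fin => zi.
  by exists (Ordinal iN).
- move=> z; have [i iN] := yY z; rewrite edistC (rdistE fY) lee_fin => zi.
  by exists (Ordinal iN).
Unshelve. all: by end_near. Qed.

End NearCompact.

Section Projection.
Context {R : realType}.
Implicit Types (x y : GH R).

Lemma Mrho_GHproj x y : Mrho (GHproj x) (GHproj y) = rho (GHspace x) (GHspace y).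
Proof. exact: Mrho_class. Qed.

(** Each rho_N is at most N times d_GH, and N / 2 ^ N sums up to 2. *)
Lemma GHproj_lipschitz x y : Mrho (GHproj x) (GHproj y) <= 3%:E * dGH x y.
Proof.
rewrite Mrho_GHproj; apply: (@le_trans _ _ (2%:E * dGH x y)); last first.
  by rewrite lee_wpmul2r ?dGH_ge0// lee_fin; lra.
apply: le_of_lt_fin => r; rewrite muleC -lte_pdivlMr// => xyr.
rewrite -EFinM in xyr; have r0 : (0 <= r * 2^-1)%R.
  by rewrite -lee_fin; apply: le_trans (dGH_ge0 x y) (ltW xyr).
rewrite [r](_ : _ = 2 * (r * 2^-1))%R; last by field.
apply: rho_le_linear => // m; apply: rhoN_GHdist => //; exact: cm_finite.
Qed.

Lemma rho_small_dGH x (e : R) : (0 < e)%R -> exists2 c : R, (0 < c)%R &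
  forall y, Mrho (GHproj x) (GHproj y) < c%:E -> dGH x y < e%:E.
Proof.
move=> e0; have e40 : (0 < e / 4)%R by rewrite divr_gt0.
have [m [c c0 h]] := compact_rhoN_GHdist (GHspace x) e40.
exists (2 ^- m.+1 * c)%R; first by rewrite mulr_gt0// invr_gt0 exprn_gt0.
move=> y; rewrite Mrho_GHproj => /rho_lt_rhoN xy.
apply: le_lt_trans (h _ (@cm_finite _ (GHspace y)) xy) _; rewrite lte_fin; lra.
Qed.

Lemma GHproj_inj : injective (@GHproj R).
Proof.
move=> x y xy; rewrite -[x]reprK -[y]reprK; apply/GHclass_eq.
apply: GHdist0_isometric => e e0; have [c c0] := rho_small_dGH x e0; apply.
by rewrite xy Mrhoxx.
Qed.

Lemma GHproj_embedding : topological_embedding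
  (@GHproj R : dtop (@dGH R) -> dtop (@Mrho R)).
Proof.
split; first exact: GHproj_inj.
- move=> x A xA; have [e e0 eA] := dtop_nbhs_sub xA.
  have e30 : (0 < e / 3)%R by rewrite divr_gt0.
  have := dtop_nbhs_ball dGH_ge0 dGHxx dGH_triangle x e30.
  apply: filterS => y /= xy; apply: eA => /=.
  apply: le_lt_trans (GHproj_lipschitz x y) _.
  have -> : e%:E = 3%:E * (e / 3)%:E by rewrite -EFinM; congr _%:E; field.
  by rewrite lte_pmul2l.
- move=> U oU.
  pose D := [set p : GH R * R | (0 < p.2)%R /\
    [set y | Mrho (GHproj p.1) (GHproj y) < p.2%:E] `<=` U].
  exists (\bigcup_(p in D) [set m | Mrho (GHproj p.1) m < p.2%:E]).
    apply: bigcup_open => p _.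
    exact: dtop_open_ball Mrho_ge0 Mrho_triangle _ _.
  apply/seteqP; split=> [y [[x c] [c0 /= cU] /cU]//|x Ux].
  have [e e0 eU] := oU x Ux; have [c c0 ce] := rho_small_dGH x e0.
  exists (x, c); last by rewrite /= Mrhoxx.
  by split=> // y /= /ce; exact: eU.
Qed.

End Projection.

(** * Pyramids *)

Section Pyramids.
Context {R : realType}.

Lemma dGH_closedP (P : set (GH R)) :
  closed (P : set (dtop (@dGH R))) <->
  forall x, (forall e : R, (0 < e)%R -> exists2 y, P y & dGH x y < e%:E) -> P x.
Proof.
split=> [cP x xP|h x xP].
  apply: cP => A xA; have [e e0 eA] := dtop_nbhs_sub xA.
  by have [y Py /eA] := xP e e0; exists y.
apply: h => e e0.
have [y [Py xy]] := xP _ (dtop_nbhs_ball dGH_ge0 dGHxx dGH_triangle x e0).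
by exists y.
Qed.

Lemma dominates_dGH (x y : GH R) N b (e : R) : dGH x y < e%:E ->
  dominates (GHspace x) N (fun i j => b i j + 2 * e)%R -> dominates (GHspace y) N b.
Proof. apply: dominates_GHdist; exact: cm_finite. Qed.

(** Directedness: approximate the two spaces so that each approximation is
    governed by one dominated matrix ([compact_approx]); a finite part of X that
    dominates the block matrix of both lies above the two approximations. *)
Lemma below_pyramid (X : emetric R) : is_pyramid (below X).
Proof.
split.
- by move=> x y xy; exact: prec_trans.
- move=> e x y e0 xX yX.
  have [N [b [x' [xb xx' bx']]]] := compact_approx x e0.
  have [N' [b' [y' [yb yy' by']]]] := compact_approx y e0.
  have Xb := prec_dominates xX xb; have Xb' := prec_dominates yX yb.
  have /dominates_witness[z zX /dominates_merge[zb zb']] :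
    dominates X (N + N') (merge N b b') by apply/dominates_merge.
  exists x', y', z; split; first by split; [exact: bx'|exact: by'|].
  by split=> //; [exact: bx'|exact: by'].
- by have [F [FX _]] := Pbounded_neq0 X 0; exists F.
- apply/dGH_closedP => x xX; apply/precP => N b /dominates_open[e e0 xb].
  have e20 : (0 < e / 2)%R by rewrite divr_gt0.
  have [y yX xy] := xX _ e20; apply: (prec_dominates yX).
  apply: dominates_dGH xy _; apply: dominates_le xb => i j _ _.
  by rewrite mulrC divfK.
Qed.

Lemma Mpyramid_pyramid (m : Mquot R) : is_pyramid (Mpyramid m).
Proof. exact: below_pyramid. Qed.

Lemma Mpyramid_inj : injective (@Mpyramid R).
Proof.
suff le (m m' : Mquot R) : Mpyramid m = Mpyramid m' -> prec (repr m) (repr m').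
  move=> m m' mm'; rewrite -(Mclass_repr m) -(Mclass_repr m'); apply/Mclass_eq.
  by split; apply: le.
move=> mm'; apply/precP => N b /dominates_witness[z].
by rewrite -/(Mpyramid m) mm' => zm' ; exact: prec_dominates.
Qed.

(** The filter is based on the sets of members of P that dominate a given
    matrix. Directedness of P makes these sets a filter base, via block
    matrices and the openness of domination. *)
Lemma pyramid_realized (P : set (GH R)) : is_pyramid P ->
  exists2 m : Mquot R, Mpyramid m = P &
    closure (range (@GHproj R) : set (dtop (@Mrho R))) m.
Proof.
move=> [Pdown Pdir [x0 Px0] /dGH_closedP Pclosed].
pose D := [set c : nat * (nat -> nat -> R) |
  exists2 x, P x & dominates (GHspace x) c.1 c.2].
pose B (c : nat * (nat -> nat -> R)) : set (dtop (@Mrho R)) :=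
  @GHproj R @` [set x | P x /\ dominates (GHspace x) c.1 c.2].
have fB : Filter (filter_from D B).
  apply: filter_from_filter.
    exists (0%N, fun _ _ => 0%R), x0 => //.
    by have [x _] := em_nonempty (GHspace x0); exists (fun=> x).
  move=> [N b] [N' b'] [x Px /= /dominates_open[e e0 xb]].
  move=> [y Py /= /dominates_open[e' e'0 yb']].
  pose d := Num.min (e / 4)%R (e' / 4)%R.
  have d0 : (0 < d)%R by rewrite lt_min !divr_gt0.
  have [de de'] : (d <= e / 4)%R /\ (d <= e' / 4)%R by rewrite !ge_min !lexx orbT.
  have [x' [y' [z [[Px' Py' Pz] [xx' yy' x'z y'z]]]]] := Pdir d x y d0 Px Py.
  have lt2d : d%:E < (2 * d)%:E by rewrite lte_fin; lra.
  have zb : dominates (GHspace z) N b.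
    apply: (prec_dominates x'z); apply: (dominates_dGH (le_lt_trans xx' lt2d)).
    by apply: dominates_le xb => i j _ _; lra.
  have zb' : dominates (GHspace z) N' b'.
    apply: (prec_dominates y'z); apply: (dominates_dGH (le_lt_trans yy' lt2d)).
    by apply: dominates_le yb' => i j _ _; lra.
  exists ((N + N')%N, merge N b b'); first by exists z => //; apply/dominates_merge.
  by move=> _ [t [Pt /dominates_merge[tb tb']] <-]; split; exists t.
have pB : ProperFilter (filter_from D B).
  by apply: filter_from_proper => c [x Px xc]; exists (GHproj x), x.
have [F [UF BF]] := ultraFilterLemma pB; have pF := @ultra_proper _ _ UF.
have FB c : D c -> F (B c) by move=> Dc; apply: BF; exists c.
have := @Mquot_compact R; rewrite compact_ultra => /(_ F UF filterT)[m [_ Fm]].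
(* each set of the filter base meets each neighbourhood of m *)
have near_m c : D c -> forall k (e : R), (0 < e)%R -> exists z,
    [/\ P z, dominates (GHspace z) c.1 c.2 & rhoN k.+1 (repr m) (GHspace z) < e%:E].
  move=> Dc k e e0; have ke0 : (0 < 2 ^- k.+1 * e)%R.
    by rewrite mulr_gt0// invr_gt0 exprn_gt0.
  have Fe := Fm _ (dtop_nbhs_ball Mrho_ge0 Mrhoxx Mrho_triangle m ke0).
  have [p [/= mp [z [Pz zc] zE]]] := filter_ex (filterI Fe (FB c Dc)).
  exists z; split=> //; apply: rho_lt_rhoN.
  by rewrite -Mrho_class Mclass_repr; move: mp; rewrite -zE.
have c0 : D (0%N, fun _ _ => 0%R).
  exists x0 => //; have [x _] := em_nonempty (GHspace x0); by exists (fun=> x).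
exists m; last first.
  move=> A mA; have [y [Ay [z _ zE]]] := filter_ex (filterI (Fm _ mA) (FB _ c0)).
  by exists y; split=> //; exists z.
apply/seteqP; split=> y.
- move=> ym; apply: Pclosed => e e0; have e20 : (0 < e / 2)%R by rewrite divr_gt0.
  have [N [b [y' [yb yy' by']]]] := compact_approx y e20.
  have /dominates_open[d d0 mb] := prec_dominates ym yb.
  have [k hk] := dominates_rhoN N b (d / 2)%R.
  have [|z [Pz _ mz]] := near_m _ c0 k (d / 2)%R; first by rewrite divr_gt0.
  exists y'; last by apply: le_lt_trans yy' _; rewrite lte_fin; lra.
  apply: Pdown Pz; apply: by'; apply: hk mz _.
  by apply: dominates_le mb => i j _ _; rewrite mulrC divfK.
- move=> Py; apply/precP => N b /dominates_open[d d0 yb].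
  have [k hk] := dominates_rhoN N b (d / 2)%R.
  have Dc : D (N, (fun i j => b i j + d)%R) by exists y.
  have [|z [Pz /= zb mz]] := near_m _ Dc k (d / 2)%R; first by rewrite divr_gt0.
  apply: hk; first by rewrite rhoNC; exact: mz.
  by apply: dominates_le zb => i j _ _; rewrite mulrC divfK.
Qed.

Lemma Mpyramid_bij : set_bij [set: Mquot R] (@is_pyramid R) (@Mpyramid R).
Proof.
split; first by move=> m _; exact: Mpyramid_pyramid.
  by move=> m m' _ _; exact: Mpyramid_inj.
by move=> P /pyramid_realized[m mP _]; exists m.
Qed.

(** The class m' found for the pyramid of m is a limit of compact spaces, and it
    equals m. *)
Lemma GHproj_dense : dense (range (@GHproj R) : set (dtop (@Mrho R))).
Proof.
move=> O [m Om] oO.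
have [m' /Mpyramid_inj -> m'cl] := pyramid_realized (Mpyramid_pyramid m).
have [p [rp Op]] := m'cl O (open_nbhs_nbhs (conj oO Om)).
by exists p.
Qed.

End Pyramids.

(** * Ultralimits of convergent sequences *)

Section Ultralimits.
Context {R : realType}.

Lemma nonprincipal_cofinite (w : set_system nat) (Uw : UltraFilter w) :
  nonprincipal w -> \oo `<=` w.
Proof.
move=> npw A [k _ kA]; have pw := @ultra_proper _ _ Uw.
apply: filterS kA _; elim: k => [|k IH]; first by apply: filterS filterT.
have [/npw//|wk] := in_ultra_setVsetC [set k] Uw.
apply: filterS (filterI IH wk) => n [/= kn nk].
by rewrite ltn_neqAle kn andbT; apply/eqP => kE; apply: nk.
Qed.

Lemma ultralimit_equivalent (X : nat -> emetric R) (Y : emetric R) :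
  rho (X n) Y @[n --> \oo] --> 0 ->
  forall (w : set_system nat) (Uw : UltraFilter w),
    nonprincipal w -> equivalent (ultralimit Uw X) Y.
Proof.
move=> XY w Uw npw; have pw := @ultra_proper _ _ Uw.
suff UY m : rhoN m.+1 (ultralimit Uw X) Y = 0.
  by split; apply: rhoN_eq0_prec => // m; rewrite rhoNC.
apply/eqP; rewrite eq_le rhoN_ge0 andbT; apply/lee_addgt0Pr => e e0; rewrite add0e.
have e20 : (0 < e / 2)%R by rewrite divr_gt0.
have wU := ultraproduct_rhoN Uw m (ultralimit_ultraproduct Uw X) e20.
have me0 : (0 < 2 ^- m.+1 * (e / 2))%R by rewrite mulr_gt0// invr_gt0 exprn_gt0.
have wY : w [set n | rho (X n) Y < (2 ^- m.+1 * (e / 2))%:E].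
  apply: (nonprincipal_cofinite Uw npw); apply: (XY [set r | r < _]).
  apply: open_nbhs_nbhs; split; first exact: open_ereal_lt_ereal.
  by rewrite /= lte_fin.
have [n [/= nU /rho_lt_rhoN nY]] := filter_ex (filterI wU wY).
apply: le_trans (rhoN_triangle m _ (X n) _) _.
rewrite (splitr e) EFinD leeD//; last exact: ltW.
by rewrite rhoNC.
Qed.

End Ultralimits.

Theorem theorem1p2 (R : realType) :
  (* M/~ is identified with the set of pyramids through [X] |-> P_X *)
  set_bij [set: Mquot R] (@is_pyramid R) (@Mpyramid R) /\
  (* (1) *)
  (is_metric (@Mrho R) /\ compact [set: dtop (@Mrho R)]) /\
  (* (2) *)
  ((forall x y : GH R,
      Mrho (GHproj x) (GHproj y) <= 3%:E * dGH x y) /\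
   topological_embedding
     (@GHproj R : dtop (@dGH R) -> dtop (@Mrho R))) /\
  (* (3) *)
  dense (range (@GHproj R) : set (dtop (@Mrho R))) /\
  (* (4) *)
  (forall (X : nat -> emetric R) (Y : emetric R),
     rho (X n) Y @[n --> \oo] --> 0 ->
     forall (w : set_system nat) (Uw : UltraFilter w),
       nonprincipal w -> equivalent (ultralimit Uw X) Y).
Proof.
split; first exact: Mpyramid_bij.
split; first by split; [exact: Mrho_is_metric|exact: Mquot_compact].
split; first by split; [exact: GHproj_lipschitz|exact: GHproj_embedding].
by split; [exact: GHproj_dense|exact: ultralimit_equivalent].
Qed.
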